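(* Let $T:\mathcal{M}_d(\mathbb{C})\to\mathcal{M}_d(\mathbb{C})$ be a trace-preserving Schwarz map. Then there exist finitely many indices $c$, positive integers $n_c,d_c$ with $\sum_cn_cd_c\le d$, and vectors $\mu^{(c)}\in\mathbb{C}^{d_c}$ with $|\mu^{(c)}_k|=1$ for all $k$, such that the peripheral spectrum of $T$, counted with algebraic multiplicity, is the multiset of the $\sum_cn_cd_c^2$ numbers $$\mu^{(c)}_k\,\overline{\mu^{(c)}_l}\,e^{2\pi i m/n_c},\qquad k,l\in\{1,\dots,d_c\},\ m\in\{0,\dots,n_c-1\},\ c \text{ ranging over the indices}.$$ Conversely, given any such data $(n_c,d_c,\mu^{(c)})$, there is a completely positive, trace-preserving, unital linear map $T$ on $\mathcal{M}_d(\mathbb{C})$ with $d=\sum_cn_cd_c$ whose peripheral spectrum (with multiplicity) is exactly this multiset and which has no other non-zero eigenvalue.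
   Context: The peripheral spectrum of a trace-preserving positive map $T$ is the multiset of its eigenvalues of modulus one (counted with algebraic multiplicity). A positive trace-preserving linear map $T$ on $\mathcal{M}_d(\mathbb{C})$ is a Schwarz map if its adjoint $T^*$ (defined by $\mathrm{tr}[AT^*(B)]=\mathrm{tr}[T(A)B]$) satisfies $T^*(A^\dagger A)\ge T^*(A^\dagger)T^*(A)$ for all $A$; every completely positive trace-preserving map is a Schwarz map. Unital: $T(\mathbbm{1})=\mathbbm{1}$. *)

(* Defs.v *)
From HB Require Import structures.
From mathcomp Require Import all_boot all_order all_algebra all_field.
Set Implicit Arguments. Unset Strict Implicit. Unset Printing Implicit Defensive.
Import Order.TTheory GRing.Theory Num.Theory.
Local Open Scope ring_scope.

Definition psdf {C : numClosedFieldType} (I : finType) (A : I -> I -> C) : Prop :=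
  forall v : I -> C, 0 <= \sum_i \sum_j (v i)^* * A i j * v j.

Definition psd {C : numClosedFieldType} d (A : 'M[C]_d) : Prop := psdf (fun i j => A i j).

Definition adjm {C : numClosedFieldType} d (A : 'M[C]_d) : 'M[C]_d := (map_mx Num.conj A)^T.

Definition lin_map {C : numClosedFieldType} d (T : 'M[C]_d -> 'M[C]_d) : Prop :=
  forall (a : C) A B, T (a *: A + B) = a *: T A + T B.

Definition positive_map {C : numClosedFieldType} d (T : 'M[C]_d -> 'M[C]_d) : Prop :=
  forall A, psd A -> psd (T A).

Definition trace_preserving {C : numClosedFieldType} d (T : 'M[C]_d -> 'M[C]_d) : Prop :=
  forall A, \tr (T A) = \tr A.

Definition unital {C : numClosedFieldType} d (T : 'M[C]_d -> 'M[C]_d) : Prop :=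
  T 1%:M = 1%:M.

Definition is_adjoint {C : numClosedFieldType} d (T Ts : 'M[C]_d -> 'M[C]_d) : Prop :=
  forall A B, \tr (A *m Ts B) = \tr (T A *m B).

Definition schwarz {C : numClosedFieldType} d (T : 'M[C]_d -> 'M[C]_d) : Prop :=
  exists Ts, is_adjoint T Ts /\
    forall A, psd (Ts (adjm A *m A) - Ts (adjm A) *m Ts A).

Definition blockf {C : numClosedFieldType} k d (X : 'I_k -> 'I_k -> 'M[C]_d)
  : ('I_k * 'I_d)%type -> ('I_k * 'I_d)%type -> C :=
  fun p q => X p.1 q.1 p.2 q.2.

Definition completely_positive {C : numClosedFieldType} d (T : 'M[C]_d -> 'M[C]_d) : Prop :=
  forall k (X : 'I_k -> 'I_k -> 'M[C]_d),
    psdf (blockf X) -> psdf (blockf (fun i j => T (X i j))).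

Definition eig_mult {C : numClosedFieldType} d (T : 'M[C]_d -> 'M[C]_d) (z : C) : nat :=
  mup z (char_poly (lin_mx T)).

(* e^{2 pi i m / n}: n.-root (-1) is the principal root e^{i pi / n} *)
Definition rou {C : numClosedFieldType} (n m : nat) : C := (n.-root (-1)) ^+ (2 * m).

Definition valid_datum {C : numClosedFieldType} (c : nat * nat * seq C) : bool :=
  let: (n, dc, mu) := c in
  [&& (0 < n)%N, (0 < dc)%N, size mu == dc & all (fun x => `|x| == 1) mu].

Definition data_dim {C : numClosedFieldType} (data : seq (nat * nat * seq C)) : nat :=
  (\sum_(c <- data) c.1.1 * c.1.2)%N.

Definition periph_list {C : numClosedFieldType} (data : seq (nat * nat * seq C)) : seq C :=
  flatten [seq (let: (n, dc, mu) := c in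
     flatten (flatten
       [seq [seq [seq mu`_k * (mu`_l)^* * rou n m | m <- iota 0 n]
              | l <- iota 0 dc] | k <- iota 0 dc]))
   | c <- data].

(* Main.v *)
(* Everything happens over an arbitrary numerically closed field, where neither
   compactness nor power-boundedness is available, so the argument is algebraic.
   Let [S] be the unital Schwarz adjoint of [T]. Jordan decomposition turns
   hermitian fixed points of [T] into positive ones; let [P] be the support of a
   dominating positive fixed point [rho]. If [X >= 0] and [S X >= X], the projection
   on the largest eigenvalue of [X] is invariant and carries a positive fixed point of
   [T], so it is not orthogonal to [P]; hence the peripheral spectrum of [T] lives on
   [f = P S(.) P]. There [rho] is faithful, the Schwarz inequality is an equality on
   peripheral eigenvectors, these are semisimple, and the eigenspaces [V_z] satisfy
   [V_z V_w <= V_zw] and [V_z^* = V_(z^* )].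
   Write [P] as a sum of minimal projections [e_i] of the algebra [V_1]. Minimality
   forces [dim (e_i V_z e_j) <= 1]; the [z] occurring for [i = j] form a finite group,
   the [n_i]-th roots of unity, and [n_i <= rank e_i] by Cayley-Hamilton. The [z]
   occurring for [(i, j)] form a coset of this group, or nothing, and the classes of
   linked indices are the data. *)
Require Import Defs.
From HB Require Import structures.
From mathcomp Require Import all_boot all_order all_algebra all_field.
From mathcomp Require Import cyclic ring.
Set Implicit Arguments. Unset Strict Implicit. Unset Printing Implicit Defensive.
Import Order.TTheory GRing.Theory Num.Theory.
Local Open Scope ring_scope.

(** * Roots of unity *)

Section RootsOfUnity.
Context {C : numClosedFieldType}.
Implicit Types (a b c s x y z g t : C) (n m : nat).

(** Only the Schwarz inequality is available, so there are no Kraus operators to argue with. It acts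
    in three ways: it makes Gram matrices of the transient pieces of an eigenvector superharmonic,
    it strengthens [P S(Q Y) P = 0] with [Q = 1 - P] to [P S(Q Y) = 0], and its equality case puts
    the peripheral eigenvectors of [f] into the multiplicative domain of [f]. In a class of linked
    indices one index serves as base: the conjugates of one chosen eigenvalue for each member are
    the phases, and the order of the common group is [n_c]. For the converse, basis vectors are
    indexed by a block, a position on a cycle of length [n_c] and an inner index. The channel
    pinches to the cells of fixed block and position, shifts them along the cycle and conjugates by
    the phases. Entries between different cells are sent to 0; on the others a Fourier transform
    along the cycle yields the [n_c d_c^2] eigenvalues. [rou] is built on [n.-root (-1)], which is
    pinned down by its maximal real part in the upper half plane; hence the inequalities on the
    circle. *)

Lemma unit_upper_cross a b c s :
  a \is Num.real -> c \is Num.real -> 0 <= b -> 0 <= s ->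
  a ^+ 2 + b ^+ 2 = 1 -> c ^+ 2 + s ^+ 2 = 1 -> a <= c -> a * s <= b * c.
Proof.
move=> aR cR b0 s0 ab cs ac.
have dE : (b * c) ^+ 2 - (a * s) ^+ 2 = (c - a) * (c + a).
  have -> : b ^+ 2 = 1 - a ^+ 2 -> s ^+ 2 = 1 - c ^+ 2 ->
     (b * c) ^+ 2 - (a * s) ^+ 2 = (c - a) * (c + a).
    by move=> h1 h2; rewrite !exprMn h1 h2; ring.
  - by [].
  - by rewrite -ab; ring.
  - by rewrite -cs; ring.
have ca0 : 0 <= c - a by rewrite subr_ge0.
case: (real_leP (real0 _) aR) => [a0|a0].
  have c0 := le_trans a0 ac.
  rewrite -(ler_pXn2r (n := 2)) ?nnegrE ?mulr_ge0 // -subr_ge0 dE.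
  by rewrite mulr_ge0 // addr_ge0.
case: (real_leP (real0 _) cR) => [c0|c0].
  by apply: (@le_trans _ _ 0); [rewrite mulr_le0_ge0 // ltW | rewrite mulr_ge0].
have a0w := ltW a0; have c0w := ltW c0.
have as0 : a * s <= 0 by rewrite mulr_le0_ge0.
have bc0 : b * c <= 0 by rewrite mulr_ge0_le0.
rewrite -lerN2 -(ler_pXn2r (n := 2)) ?nnegrE ?oppr_ge0 //.
rewrite !sqrrN -subr_le0 dE mulr_ge0_le0 // -oppr_ge0 opprD.
by rewrite addr_ge0 ?oppr_ge0.
Qed.

(** With [g = a + i b] and [t = c + i s], the terms [b * c - a * s] of [unit_upper_cross] and
    [a * c + b * s] are the imaginary and real parts of [g / t]: division by [t] keeps [g] in the
    upper half plane and moves it towards 1. *)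
Lemma unit_upper_dot a b c s :
  a \is Num.real -> c \is Num.real -> 0 <= b -> 0 <= s ->
  a ^+ 2 + b ^+ 2 = 1 -> c ^+ 2 + s ^+ 2 = 1 -> a <= c -> c < 1 ->
  a < a * c + b * s.
Proof.
move=> aR cR b0 s0 ab cs ac c1.
have c10 : 0 < 1 - c by rewrite subr_gt0.
have a1 : a < 1 by apply: le_lt_trans c1.
suff: a * (1 - c) < b * s.
  by rewrite mulrBr mulr1 ltrBlDr addrC.
case: (real_leP (real0 _) aR) => [a0|a0]; last first.
  by apply: (@lt_le_trans _ _ 0); rewrite ?mulr_ge0 // nmulr_rlt0.
rewrite -(ltr_pXn2r (n := 2)) ?nnegrE ?mulr_ge0 // ?(ltW c10) // -subr_gt0.
(* The cofactor [1 + c - 2 a^2] is split so that each summand has a visible sign for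
   [0 <= a <= c < 1]. *)
have -> : (b * s) ^+ 2 - (a * (1 - c)) ^+ 2 =
    (1 - c) * ((c - a) + ((1 - a) * (1 + a * 2))
               + 0).
  have -> : (b * s) ^+ 2 = (1 - a ^+ 2) * (1 - c ^+ 2).
    by rewrite exprMn -[X in (X - _) * _]ab -[X in _ * (X - _)]cs; ring.
  by ring.
rewrite addr0 mulr_gt0 // ltr_wpDl ?subr_ge0 // mulr_gt0 ?subr_gt0 //.
by rewrite ltr_pwDl // mulr_ge0.
Qed.

Lemma prim_root_exists n : (0 < n)%N -> exists z : C, n.-primitive_root z.
Proof.
pose p : {poly C} := 'X^n - 1; have [r Dp] := closed_field_poly_normal p.
move=> n_gt0; rewrite (monicP _) ?monicXnsubC // scale1r in Dp.
have rn1: all n.-unity_root r by apply/allP=> z; rewrite -root_prod_XsubC -Dp.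
have sz_r: (n < (size r).+1)%N.
  by rewrite -(size_prod_XsubC r id) -Dp size_XnsubC.
have [|z] := hasP (has_prim_root n_gt0 rn1 _ sz_r); last by exists z.
by rewrite -separable_prod_XsubC -Dp separable_Xn_sub_1 // pnatr_eq0 -lt0n.
Qed.

Lemma unity_norm n z : (0 < n)%N -> z ^+ n = 1 -> `|z| = 1.
Proof.
move=> n0 zn; apply/eqP; rewrite -(@pexpr_eq1 _ _ n) ?normr_ge0 //.
by rewrite -normrX zn normr1.
Qed.

(* On the upper half circle multiplication by [t^-1] moves a root of unity
   strictly closer to 1 when [t] is the root closest to 1, so [t] generates. *)
Lemma max_Re_generates n (t : C) : (0 < n)%N -> t ^+ n = 1 -> 0 <= 'Im t -> t != 1 ->
  (forall g : C, g ^+ n = 1 -> 0 <= 'Im g -> g != 1 -> 'Re g <= 'Re t) ->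
  n.-primitive_root t.
Proof.
move=> n0 tn It t1 tmax; have [w wprim] := prim_root_exists n0.
have nz g : g ^+ n = 1 -> g != 0.
  by move=> gn; have := oner_neq0 C; rewrite -gn expf_eq0 n0.
have n2 g : g ^+ n = 1 -> 'Re g ^+ 2 + 'Im g ^+ 2 = 1.
  by move=> gn; rewrite -normC2_Re_Im (unity_norm n0 gn) expr1n.
have Ret1 : 'Re t < 1.
  rewrite lt_def; apply/andP; split.
    apply: contra t1 => /eqP e; apply/eqP/eqCP.
    have := n2 t tn; rewrite -e expr1n => /(canRL (addKr _)).
    rewrite addNr => /eqP; rewrite sqrf_eq0 => /eqP ->.
    by rewrite (Creal_ReP 1 _) ?(Creal_ImP 1 _) ?rpred1.
  have := leif_Re_Creal t; rewrite (unity_norm n0 tn); by case.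
have gen_upper g : g ^+ n = 1 -> 0 <= 'Im g -> exists k, g = t ^+ k.
  (* Descent on the number of [n]-th roots of unity to the right of [g]; [g / t] lies strictly
     further right. *)
  have [m] := ubnP #|[set i : 'I_n | 'Re g < 'Re (w ^+ i)]|.
  elim: m g => // m IH g; rewrite ltnS => le_m gn Ig.
  have [->|g1] := eqVneq g 1; first by exists 0%N; rewrite expr0.
  have gt := tmax g gn Ig g1.
  have gtn : (g / t) ^+ n = 1 by rewrite exprMn exprVn gn tn divr1.
  have nt2 : `|t| ^+ 2 = 1 by rewrite (unity_norm n0 tn) expr1n.
  have [||k gk] := IH (g / t) _ gtn; last first.
  - by exists k.+1; rewrite exprSr -gk mulfVK // nz.
  - rewrite Im_div nt2 divr1 subr_ge0 mulrC [leRHS]mulrC.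
    rewrite mulrC; apply: unit_upper_cross => //; rewrite ?Creal_Re //; exact: n2.
  have lt_Re : 'Re g < 'Re (g / t).
    rewrite Re_div nt2 divr1; apply: unit_upper_dot => //; rewrite ?Creal_Re //; exact: n2.
  apply: leq_trans le_m; apply: proper_card; apply/properP; split.
    by apply/subsetP => i; rewrite !inE; apply: lt_trans.
  have [i gi] := prim_rootP wprim gtn.
  by exists i; rewrite !inE -gi ?lt_Re ?ltxx.
have [k wk] : exists k, w = t ^+ k.
  have wn := prim_expr_order wprim.
  case: (real_leP (real0 _) (Creal_Im w)) => [Iw|Iw]; first exact: gen_upper.
  have [||k wk] := gen_upper w^-1.
  - by rewrite exprVn wn invr1.
  - by rewrite ImV (unity_norm n0 wn) expr1n divr1 oppr_ge0 ltW.
  (* Here [w^-1 = t ^+ k], and [w] is the power [n - 1] of its own inverse. *)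
  exists (n.-1 * k)%N; rewrite mulnC exprM -wk -[LHS]mulr1.
  apply: (mulfI (_ : w^-1 != 0)); first by rewrite invr_eq0 nz.
  rewrite -exprS prednK // exprVn wn invr1 mulr1 mulVf // nz //.
have [o oprim on] := prim_order_exists n0 tn.
have : (n %| o)%N.
  by rewrite (prim_order_dvd wprim) wk exprAC (prim_expr_order oprim) expr1n.
by move=> no; have /eqP <- : o == n by rewrite eqn_dvd on no.
Qed.

(** Among its competitors in the upper half plane [n.-root (-1)] has the largest real part, so it
    coincides with the generator that [max_Re_generates] finds among the [2 n]-th roots of unity. *)
Lemma rou_prim n : (0 < n)%N -> n.-primitive_root (rou n 1 : C).
Proof.
move=> n0; have [->|n1] := eqVneq n 1%N.
  rewrite /rou root1C muln1 sqrrN expr1n; apply/andP; split=> //.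
  by apply/forallP => i; rewrite ord1 unity_rootE expr1n !eqxx.
have {n1}n1 : (1 < n)%N by rewrite ltn_neqAle eq_sym n1.
have n20 : (0 < 2 * n)%N by rewrite muln_gt0.
pose y : C := n.-root (-1); have yn : y ^+ n = -1 by rewrite rootCK.
have Iy : 0 <= 'Im y by rewrite Im_rootC_ge0.
have N11 : -1 != 1 :> C by rewrite -subr_eq0 -opprD oppr_eq0 (pnatr_eq0 _ 2).
have y1 : y != 1 by apply/eqP=> e; move: N11; rewrite -yn e expr1n eqxx.
have y2n : y ^+ (2 * n) = 1 by rewrite mulnC exprM yn sqrrN expr1n.
suff yprim : (2 * n).-primitive_root y.
  rewrite /rou -/y muln1.
  by have := exp_prim_root yprim 2; rewrite gcdnMr mulKn.
have [w wprim] := prim_root_exists n20.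
have [i0 yi0] := prim_rootP wprim y2n.
pose U := [pred i : 'I_(2 * n) | (0 <= 'Im (w ^+ i)) && (w ^+ i != 1)].
have Ui0 : U i0 by rewrite /U /= -yi0 Iy.
case: (@real_arg_maxP C 'I_(2 * n) i0 U (fun i => 'Re (w ^+ i)) Ui0).
  by move=> i _; apply: Creal_Re.
move=> i /andP[It t1] tmax; set t := w ^+ i in It t1 tmax.
have t2n : t ^+ (2 * n) = 1 by rewrite exprAC (prim_expr_order wprim) expr1n.
have tmax' g : g ^+ (2 * n) = 1 -> 0 <= 'Im g -> g != 1 -> 'Re g <= 'Re t.
  by move=> gn Ig g1; have [j gj] := prim_rootP wprim gn; rewrite gj; apply: tmax; rewrite /U /= -gj Ig.
have tprim := max_Re_generates n20 t2n It t1 tmax'.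
have tn : t ^+ n = -1.
  have /eqP : (t ^+ n) ^+ 2 = 1 by rewrite -exprM mulnC.
  rewrite sqrf_eq1 => /orP[/eqP tn|/eqP //].
  have := prim_order_dvd tprim n; rewrite tn eqxx => /(dvdn_leq n0).
  by rewrite leqNgt -{1}[n]mul1n ltn_pmul2r.
suff -> : y = t by [].
have Re_yt : 'Re y = 'Re t.
  by apply/eqP; rewrite eq_le tmax' //= (rootC_Re_max n0 tn It).
apply/eqCP; split=> //; apply/eqP; rewrite -(eqrXn2 (n := 2)) //.
have := normC2_Re_Im y; have := normC2_Re_Im t.
by rewrite (unity_norm n20 y2n) (unity_norm n20 t2n) Re_yt => -> /addrI ->.
Qed.

Lemma rouE n m : rou n m = rou n 1 ^+ m :> C.
Proof. by rewrite /rou muln1 exprM. Qed.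

Lemma rou_expr n m : (0 < n)%N -> rou n m ^+ n = 1 :> C.
Proof. by move=> n0; rewrite rouE exprAC (prim_expr_order (rou_prim n0)) expr1n. Qed.

Lemma count_rou n z : (0 < n)%N ->
  count_mem z [seq rou n m | m <- iota 0 n] = (z ^+ n == 1).
Proof.
move=> n0; have pr := rou_prim n0; rewrite count_uniq_mem.
  congr (nat_of_bool _); apply/mapP/eqP => [[m _ ->]|zn]; first exact: rou_expr.
  have [i ->] := prim_rootP pr zn; exists (i : nat); last by rewrite (rouE n i).
  by rewrite mem_iota /=.
rewrite map_inj_in_uniq ?iota_uniq // => i j; rewrite !mem_iota /= => iL jL.
rewrite (rouE n i) (rouE n j) => /eqP; rewrite (eq_prim_root_expr pr).
by rewrite !modn_small // => /eqP.
Qed.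

End RootsOfUnity.

(** * Assembling the peripheral data *)

Section PeripheralData.
Context {C : numClosedFieldType}.
Implicit Types (z w : C).

(** Multiplication by [z] permutes the finite set, so comparing products gives [z ^+ n = 1] for its
    size [n]; one more root would exceed the degree. Finiteness replaces closure under inverses. *)
Lemma finite_group_unity (G : pred C) (L : seq C) :
  (forall z, G z -> z \in L) -> (forall z, G z -> z != 0) -> G 1 ->
  (forall z w, G z -> G w -> G (z * w)) ->
  exists2 n, (0 < n)%N & forall z, G z = (z ^+ n == 1).
Proof.
move=> GL Gn0 G1 GM; pose U := undup (filter G L).
have UE z : (z \in U) = G z.
  rewrite mem_undup mem_filter; case Gz: (G z) => //=; exact: GL.
have Uu : uniq U := undup_uniq _.
have U1 : 1 \in U by rewrite UE.
have n0 : (0 < size U)%N by rewrite -has_predT; apply/hasP; exists 1.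
have Gn z : G z -> z ^+ size U = 1.
  move=> Gz; have zi := mulfI (Gn0 z Gz).
  have pU : perm_eq U [seq z * u | u <- U].
    rewrite perm_sym; apply: uniq_perm => //; first by rewrite map_inj_uniq.
    apply: (uniq_min_size _ _ _).2; rewrite ?map_inj_uniq ?size_map //.
    by move=> _ /mapP[u + ->]; rewrite !UE; apply: GM.
  have P0 : \prod_(u <- U) u != 0.
    by rewrite prodf_seq_neq0; apply/allP => u; rewrite UE => /Gn0 ->.
  have e : \prod_(u <- U) u = \prod_(u <- [seq z * u | u <- U]) u by apply: perm_big.
  rewrite big_map big_split /= big_const_seq count_predT iter_mulr_1 in e.
  by apply: (mulIf P0); rewrite mul1r -e.
exists (size U) => // z; apply/idP/eqP => [|zn]; first exact: Gn.
rewrite -UE; apply: contraT => zU.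
have := @max_unity_roots C (size U) (z :: U) n0.
rewrite /= zU Uu ltnn; apply => //; rewrite unity_rootE zn eqxx /=.
by apply/allP => u; rewrite UE unity_rootE => /Gn ->.
Qed.

Lemma count_mem_block (n dc : nat) (mu : seq C) z : size mu = dc ->
  count_mem z (flatten (flatten
       [seq [seq [seq mu`_k * (mu`_l)^* * rou n m | m <- iota 0 n]
              | l <- iota 0 dc] | k <- iota 0 dc])) =
  (\sum_(x <- mu) \sum_(y <- mu)
     count_mem z [seq (x * y^* * rou n m)%R | m <- iota 0 n])%N.
Proof.
move=> sz; rewrite count_flatten sumnE big_map big_flatten big_map.
rewrite [RHS](big_nth 0) sz /index_iota subn0; apply: eq_bigr => k _.
by rewrite big_map [RHS](big_nth 0) sz /index_iota subn0.
Qed.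

(* An index [i] stands for a minimal projection, [D i j] for the set of
   eigenvalues occurring in the corner [i, j]; each class of indices linked by a
   nonempty [D i j] yields one datum. *)
Lemma peripheral_data (I : eqType) (D : I -> I -> C -> bool) (L : seq C)
    (n : I -> nat) (s : seq I) :
  (forall i j z, D i j z -> z \in L) -> (forall i j z, D i j z -> `|z| = 1) ->
  (forall i, 0 < n i)%N -> (forall i z, D i i z = (z ^+ n i == 1)) ->
  (forall i j z, D i j z -> D j i z^*) ->
  (forall i j k z w, D i j z -> D j k w -> D i k (z * w)) ->
  exists data : seq (nat * nat * seq C),
    [/\ all valid_datum data, data_dim data = (\sum_(i <- s) n i)%N &
     forall z, count_mem z (periph_list data) = (\sum_(i <- s) \sum_(j <- s) D i j z)%N].
Proof.
move=> DL Dnorm n0 Ddiag Dsym Dtrans.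
have Dcancel i j k z w : D i j z -> D j k w = D i k (z * w).
  move=> Dz; apply/idP/idP => [|Dzw]; first exact: Dtrans.
  by have := Dtrans _ _ _ _ _ (Dsym _ _ _ Dz) Dzw; rewrite mulrA mulrC -normCKC (Dnorm _ _ _ Dz) expr1n mulr1.
have Dcancelr i j k z w : D j k w -> D i j z = D i k (z * w).
  move=> Dw; apply/idP/idP => [Dz|Dzw]; first exact: Dtrans Dw.
  by have := Dtrans _ _ _ _ _ Dzw (Dsym _ _ _ Dw); rewrite -mulrA -normCK (Dnorm _ _ _ Dw) expr1n mulr1.
pose r i j := has (D i j) L.
have rI i j z : D i j z -> r i j by move=> Dz; apply/hasP; exists z; rewrite ?(DL i j).
have [N] := ubnP (size s); elim: N s => // N IH [|i0 s'] sN.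
  by exists [::]; split=> [||z]; rewrite /data_dim /periph_list ?big_nil //.
set s := i0 :: s' in sN *.
pose c := filter (r i0) s; pose rest := filter (predC (r i0)) s.
have r0 : r i0 i0 by apply: (rI _ _ 1); rewrite Ddiag expr1n.
have [data [dv ddim dcount]] : exists data : seq (nat * nat * seq C),
    [/\ all valid_datum data, data_dim data = (\sum_(i <- rest) n i)%N &
     forall z, count_mem z (periph_list data) = (\sum_(i <- rest) \sum_(j <- rest) D i j z)%N].
  apply: IH; move: sN; rewrite /rest /s /= r0 /= ltnS => sN.
  by apply: leq_ltn_trans sN; rewrite size_filter count_size.
(* One eigenvalue linking [i0] to [j]; for [j] in [c] the list is nonempty, so the default 0 does
   not occur. *)
pose m j := nth 0 (filter (D i0 j) L) 0.
have mP j : j \in c -> D i0 j (m j).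
  rewrite mem_filter => /andP[]; rewrite /r has_filter /m => + _.
  by case E: (filter _ _) => [//|x l] _ /=; have := mem_head x l; rewrite -E mem_filter => /andP[].
have pe : perm_eq s (c ++ rest) by rewrite perm_sym perm_filterC.
(* For [i] and [j] in the class, [D i j z] means that [m i * z * (m j)^*] lies in the group of [i0],
   so [z] is [(m i)^* * m j] times a root of unity; hence the conjugates. *)
exists ((n i0, size c, [seq (m j)^* | j <- c]) :: data); split.
- rewrite /= dv andbT n0 size_map eqxx /= all_map; apply/andP; split.
    by rewrite size_filter -has_count; apply/hasP; exists i0; rewrite ?mem_head.
  by apply/allP => j /mP /Dnorm /= e; rewrite norm_conjC e eqxx.
- rewrite /data_dim big_cons /= -/(data_dim data) ddim (perm_big _ pe) big_cat /=.
  congr (_ + _)%N; rewrite (eq_big_seq (fun=> n i0)) ?big_const_seq ?count_predT ?iter_addn_0 // => j /mP Dj.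
  have Djj z : (z ^+ n j == 1) = (z ^+ n i0 == 1).
    by rewrite -!Ddiag (Dcancel _ _ _ _ _ Dj) (Dcancelr _ _ _ _ _ Dj) mulrC.
  have pr i := @rou_prim C _ (n0 i).
  apply/eqP; rewrite eqn_dvd (prim_order_dvd (pr j)) -Djj (prim_expr_order (pr j)) eqxx.
  by rewrite (prim_order_dvd (pr i0)) Djj (prim_expr_order (pr i0)) eqxx.
- move=> z; rewrite /periph_list /= count_cat -/(periph_list data) dcount.
  rewrite count_mem_block ?size_map // big_map.
  have crossF i j : i \in c -> j \in rest -> D i j z = false /\ D j i z = false.
    move=> /mP Di; rewrite mem_filter /= => /andP[nr _].
    suff H w : D i j w = false by split=> //; apply/negP => /Dsym; rewrite H.
    by apply/negP => Dw; move: nr; rewrite (rI _ _ _ (Dtrans _ _ _ _ _ Di Dw)).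
  rewrite (perm_big _ pe) big_cat /=; congr (_ + _)%N; apply: eq_big_seq => i ic.
    rewrite (perm_big _ pe) big_cat /= [X in (_ + X)%N]big1_seq ?addn0; last first.
      by move=> j /= jr; have [-> _] := crossF _ _ ic jr.
    rewrite big_map; apply: eq_big_seq => j jc; have Di := mP _ ic; have Dj := mP _ jc.
    rewrite (Dcancel _ _ _ _ _ Di) (Dcancelr _ _ _ _ _ (Dsym _ _ _ Dj)) Ddiag -count_rou //.
    have n1 k w : D i0 k w -> w * w^* = 1 by move=> /Dnorm; rewrite -normCK => ->; rewrite expr1n.
    rewrite !count_map; apply: eq_count => k /=; rewrite conjCK.
    apply/eqP/eqP => [<-|->].
      transitivity ((m i * (m i)^*) * (m j * (m j)^*) * rou (n i0) k); last by ring.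
      by rewrite (n1 _ _ Di) (n1 _ _ Dj) !mul1r.
    transitivity ((m i * (m i)^*) * (m j * (m j)^*) * z); first by ring.
    by rewrite (n1 _ _ Di) (n1 _ _ Dj) !mul1r.
  by rewrite (perm_big _ pe) big_cat /= [X in _ = (X + _)%N]big1_seq // => j /= jr; have [_ ->] := crossF _ _ jr ic.
Qed.

End PeripheralData.

(** * Algebraic and geometric multiplicities *)

Section CharPolySimilar.
Context {F : fieldType}.

(** The equality of dimensions is a hypothesis because in a splitting along kernel and row space [m]
    is a sum of two ranks, equal to [n] only propositionally. *)
Lemma char_poly_intertwine m n (M : 'M[F]_(m, n)) (A : 'M_n) (X : 'M_m) :
  m = n -> row_free M -> M *m A = X *m M -> char_poly A = char_poly X.
Proof.
move=> e; subst m; rewrite row_free_unit unitmxE unitfE => dM MA.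
have := congr1 (map_mx polyC) MA; rewrite !map_mxM => MAp.
have /(congr1 determinant) : map_mx polyC M *m char_poly_mx A = char_poly_mx X *m map_mx polyC M.
  by rewrite /char_poly_mx mulmxBr mulmxBl MAp scalar_mxC.
rewrite !det_mulmx mulrC det_map_mx; apply: mulIf.
by rewrite polyC_eq0.
Qed.

(** The hypothesis makes the kernel and the row space of [A - z] complementary. Both are stable, so
    [A] is similar to a scalar block [z] next to a block [D] without the eigenvalue [z]. *)
Lemma mup_semisimple n (A : 'M[F]_n) z :
  (forall v : 'rV_n, v *m (A - z%:M) *m (A - z%:M) = 0 -> v *m (A - z%:M) = 0) ->
  mup z (char_poly A) = \rank (eigenspace A z).
Proof.
move=> ss; rewrite /eigenspace; set B := A - z%:M in ss *.
have AB : A = B + z%:M by rewrite subrK.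
have kA : row_base (kermx B) *m A = z%:M *m row_base (kermx B).
  have /sub_kermxP kB : (row_base (kermx B) <= kermx B)%MS by rewrite eq_row_base.
  by rewrite AB mulmxDr kB add0r scalar_mxC.
have /submxP[D rA] : (row_base B *m A <= row_base B)%MS.
  rewrite eq_row_base; apply: submx_trans (submxMl A B).
  have -> : A *m B = B *m A by rewrite AB mulmxDl [RHS]mulmxDr scalar_mxC.
  by rewrite submxMr // eq_row_base.
pose M := col_mx (row_base (kermx B)) (row_base B).
have szM : (\rank (kermx B) + \rank B)%N = n.
  by rewrite mxrank_ker subnK // rank_leq_row.
have capKB : (row_base (kermx B) :&: row_base B)%MS = 0.
  apply/eqP/rowV0P => v; rewrite sub_capmx !eq_row_base => /andP[/sub_kermxP vB /submxP[w vE]].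
  by rewrite vE ss // -vE.
have Mfree : row_free M.
  rewrite /row_free /M -addsmxE.
  have := mxrank_sum_cap (row_base (kermx B)) (row_base B).
  by rewrite capKB mxrank0 addn0 !eq_row_base => ->.
have MA : M *m A = block_mx z%:M 0 0 D *m M.
  by rewrite mul_col_mx mul_block_col !mul0mx addr0 add0r kA rA.
rewrite (char_poly_intertwine szM Mfree MA) /char_poly char_block_diag_mx det_ublock.
rewrite mupMl; last first.
  rewrite -/(char_poly D) -eigenvalue_root_char; apply/negP => /eigenvalueP[u uD].
  apply/negP; rewrite negbK -(mulmx_free_eq0 _ (row_base_free B)); set v := u *m _.
  have vB : v *m B = 0.
    by rewrite /B mulmxBr -[v *m A]mulmxA rA mulmxA uD -scalemxAl mul_mx_scalar subrr.
  have /submxP[w vE] : (v <= B)%MS.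
    by apply: submx_trans (submxMl _ _) _; rewrite eq_row_base.
  by rewrite vE ss // -vE.
rewrite /char_poly_mx map_scalar_mx -rmorphB det_scalar.
by rewrite -['X - _]/('X - z%:P) mup_XsubCX eqxx.
Qed.

End CharPolySimilar.

Section LinearMaps.
Context {F : fieldType} {d : nat}.
Implicit Types (f g h S T : {linear 'M[F]_d -> 'M[F]_d}) (z : F) (X Y : 'M[F]_d).

(** Geometric multiplicity; it agrees with [eig_mult] only once Jordan blocks at [z] are
    excluded. *)
Definition gdim f z := \rank (eigenspace (lin_mx f) z).

Lemma mxvec_eigenspace f z X :
  (mxvec X <= eigenspace (lin_mx f) z)%MS = (f X == z *: X).
Proof.
by apply/eigenspaceP/eqP; rewrite mul_vec_lin -linearZ; [apply: (can_inj mxvecK) | move=> ->].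
Qed.

Lemma gdim_gt0P f z : reflect (exists2 X, f X = z *: X & X != 0) (0 < gdim f z)%N.
Proof.
rewrite /gdim lt0n mxrank_eq0; apply: (iffP rowV0Pn) => [[v]|[X fX X0]].
  rewrite -[v]vec_mxK mxvec_eigenspace => /eqP fX v0; exists (vec_mx v) => //.
  by apply: contra v0 => /eqP->; rewrite linear0.
exists (mxvec X); first by rewrite mxvec_eigenspace fX.
by rewrite mxvec_eq0.
Qed.

Lemma gdim_le f h g z : (forall X, f X = z *: X -> h (g X) = z *: g X) ->
  (forall X, f X = z *: X -> g X = 0 -> X = 0) -> (gdim f z <= gdim h z)%N.
Proof.
move=> fh g0; rewrite /gdim -(mxrank_mul_ker _ (lin_mx g)).
rewrite [X in (_ + X)%N](_ : _ = 0%N) ?addn0; last first.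
  apply/eqP; rewrite mxrank_eq0; apply/eqP/eqP/rowV0P => v.
  rewrite sub_capmx => /andP[]; rewrite -[v]vec_mxK mxvec_eigenspace => /eqP fX.
  move=> /sub_kermxP; rewrite mul_vec_lin => /eqP; rewrite mxvec_eq0 => /eqP gX.
  by rewrite (g0 _ fX gX) linear0.
apply: mxrankS; apply/row_subP => i; rewrite row_mul.
have := row_sub i (eigenspace (lin_mx f) z).
rewrite -[row i _]vec_mxK mxvec_eigenspace mul_vec_lin mxvec_eigenspace.
by move=> /eqP /fh ->.
Qed.

Lemma eig_mult_semisimple f z :
  (forall X Y, f Y = z *: Y -> f X = z *: X + Y -> Y = 0) ->
  mup z (char_poly (lin_mx f)) = gdim f z.
Proof.
move=> ss; apply: mup_semisimple => v.
have BE X : mxvec X *m (lin_mx f - z%:M) = mxvec (f X - z *: X).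
  by rewrite mulmxBr mul_mx_scalar mul_vec_lin -linearZ -linearB.
rewrite -[v]vec_mxK !BE => /eqP; rewrite mxvec_eq0 subr_eq0 => /eqP fY.
by rewrite (ss (vec_mx v) _ fY) ?linear0 // addrC subrK.
Qed.

Lemma dot_mxvec X Y : (mxvec X *m (mxvec Y)^T) 0 0 = \tr (X^T *m Y).
Proof.
rewrite /mxtrace mxE (reindex (uncurry (@mxvec_index d d))) /=; last first.
  exact: (curry_mxvec_bij d d).
rewrite (eq_bigr (fun p => X p.1 p.2 * Y p.1 p.2)); last first.
  by case=> i j _ /=; rewrite mxE !mxvecE.
rewrite -(pair_bigA _ (fun i j => X i j * Y i j)) exchange_big /=.
by apply: eq_bigr => j _; rewrite mxE; apply: eq_bigr => i _; rewrite mxE.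
Qed.

(** In coordinates the dot product is [tr (X^T Y)], whereas adjointness refers to [tr (X Y)]; the
    transposition [J] mediates between the two pairings. *)
Lemma adjoint_lin_mx T S : (forall X Y, \tr (X *m S Y) = \tr (T X *m Y)) ->
  exists2 J, J \in unitmx & lin_mx T *m J = J *m (lin_mx S)^T.
Proof.
move=> adj; pose tr_lin : {linear 'M[F]_d -> 'M[F]_d} := @trmx F d d.
have JJ : lin_mx tr_lin *m lin_mx tr_lin = 1%:M.
  apply/row_matrixP => i; rewrite !rowE mulmx1 mulmxA -{1}[delta_mx 0 i]vec_mxK.
  by rewrite !mul_vec_lin /= trmxK vec_mxK.
exists (lin_mx tr_lin); first by case: (mulmx1_unit JJ).
apply/matrixP => i j.
have E (M : 'M[F]_(d * d)) : M i j = ((delta_mx 0 i : 'rV_(d * d)) *m M *m (delta_mx 0 j : 'rV_(d * d))^T) 0 0.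
  by rewrite -rowE trmx_delta -colE !mxE.
rewrite !E -[delta_mx 0 i]vec_mxK -[delta_mx 0 j]vec_mxK.
rewrite !mulmxA !mul_vec_lin /= dot_mxvec trmxK -adj.
by rewrite -[_ *m (lin_mx S)^T *m _]mulmxA -trmx_mul mul_vec_lin dot_mxvec trmxK.
Qed.

Lemma char_poly_adjoint T S : (forall X Y, \tr (X *m S Y) = \tr (T X *m Y)) ->
  char_poly (lin_mx T) = char_poly (lin_mx S).
Proof.
move=> /adjoint_lin_mx[J Ju JE].
rewrite -(char_poly_intertwine (M := J) (A := (lin_mx S)^T)) ?row_free_unit //.
rewrite /char_poly -det_tr /char_poly_mx linearB /= tr_scalar_mx.
by rewrite -map_trmx trmxK.
Qed.

Lemma gdim_adjoint T S z : (forall X Y, \tr (X *m S Y) = \tr (T X *m Y)) ->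
  gdim T z = gdim S z.
Proof.
move=> /adjoint_lin_mx[J Ju JE]; rewrite /gdim /eigenspace !mxrank_ker; congr (_ - _)%N.
have JE' : (lin_mx T - z%:M) *m J = J *m (lin_mx S - z%:M)^T.
  by rewrite [(_ - _)^T]linearB /= tr_scalar_mx mulmxBl mulmxBr JE scalar_mxC.
rewrite -(@mxrankMfree _ _ _ _ _ J) ?row_free_unit // JE' -mxrank_tr trmx_mul trmxK.
by rewrite mxrankMfree // row_free_unit unitmx_tr.
Qed.

End LinearMaps.

(** * Positive semidefinite matrices *)

Section Psd.
Context {C : numClosedFieldType}.

(** Rectangular form of [adjm], so that vectors and Gram factors are covered. *)
Definition hc m n (A : 'M[C]_(m, n)) : 'M[C]_(n, m) := (map_mx Num.conj A)^T.

Lemma hcE m n (A : 'M[C]_(m, n)) i j : hc A i j = (A j i)^*.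
Proof. by rewrite !mxE. Qed.

Lemma hcK m n (A : 'M[C]_(m, n)) : hc (hc A) = A.
Proof. by apply/matrixP => i j; rewrite !hcE conjCK. Qed.

Lemma hcM m n p (A : 'M[C]_(m, n)) (B : 'M_(n, p)) : hc (A *m B) = hc B *m hc A.
Proof. by rewrite /hc map_mxM trmx_mul. Qed.

Lemma hcD m n (A B : 'M[C]_(m, n)) : hc (A + B) = hc A + hc B.
Proof. by apply/matrixP => i j; rewrite [RHS]mxE !hcE mxE rmorphD. Qed.

Lemma hcN m n (A : 'M[C]_(m, n)) : hc (- A) = - hc A.
Proof. by apply/matrixP => i j; rewrite [RHS]mxE !hcE mxE rmorphN. Qed.

Lemma hcB m n (A B : 'M[C]_(m, n)) : hc (A - B) = hc A - hc B.
Proof. by rewrite hcD hcN. Qed.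

Lemma hcZ m n a (A : 'M[C]_(m, n)) : hc (a *: A) = a^* *: hc A.
Proof. by apply/matrixP => i j; rewrite [RHS]mxE !hcE mxE rmorphM. Qed.

Lemma hc0 m n : hc (0 : 'M[C]_(m, n)) = 0.
Proof. by apply/matrixP => i j; rewrite hcE !mxE conjC0. Qed.

Lemma hc1 n : hc (1%:M : 'M[C]_n) = 1%:M.
Proof. by rewrite /hc map_mx1 trmx1. Qed.

Lemma tr_gram m n (G : 'M[C]_(m, n)) : \tr (hc G *m G) = \sum_j \sum_i `|G i j| ^+ 2.
Proof.
by apply: eq_bigr => j _; rewrite mxE; apply: eq_bigr => i _; rewrite hcE normCKC.
Qed.

Lemma tr_gram_eq0 m n (G : 'M[C]_(m, n)) : \tr (hc G *m G) = 0 -> G = 0.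
Proof.
have ge0 i j : 0 <= `|G i j| ^+ 2 by rewrite exprn_ge0.
rewrite tr_gram => /eqP; rewrite psumr_eq0 => [/allP G0|j _]; last by rewrite sumr_ge0.
apply/matrixP => i j; have /= := G0 j (mem_index_enum _).
rewrite psumr_eq0 // => /allP /(_ i (mem_index_enum _)) /=.
by rewrite sqrf_eq0 normr_eq0 mxE => /eqP.
Qed.

Lemma gram_eq0 m n (G : 'M[C]_(m, n)) : hc G *m G = 0 -> G = 0.
Proof. by move=> G0; apply: tr_gram_eq0; rewrite G0 mxtrace0. Qed.

Lemma affine_ge0 (a c : C) : (forall s, s \is Num.real -> 0 <= a + s * c) -> c = 0.
Proof.
move=> h; have a0 : 0 <= a by have := h 0 (real0 _); rewrite mul0r addr0.
have aR : a \is Num.real by rewrite ger0_real.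
have cR : c \is Num.real.
  have /ger0_real := h 1 (real1 _); rewrite mul1r => acR.
  by have := realB acR aR; rewrite addrC addKr.
apply/eqP; apply: contraT => c0.
have R1 : - (a + 1) \is Num.real by rewrite realN realD ?real1.
(* At this argument the affine function takes the value -1. *)
have sR : - (a + 1) / c \is Num.real by rewrite realM ?realV.
move: (h _ sR).
by rewrite mulfVK // opprD addrA subrr add0r oppr_ge0 ler10.
Qed.

(* Replaces the Cauchy-Schwarz inequality for the semidefinite forms below. *)
Lemma pencil_ge0 (a b b' : C) : (forall t, 0 <= a + t * b + t^* * b') -> b = 0.
Proof.
(* Real [t] isolate [b + b'], imaginary [t] isolate [b - b']. *)
move=> h; have e1 : b + b' = 0.
  by apply: (@affine_ge0 a) => s /conj_Creal sR; have := h s; rewrite sR -addrA -mulrDr.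
have e2 : 'i * (b - b') = 0.
  apply: (@affine_ge0 a) => s /conj_Creal sR; have := h (s * 'i).
  rewrite rmorphM /= conjCi sR => H.
  suff -> : a + s * ('i * (b - b')) = a + s * 'i * b + s * - 'i * b' by [].
  by ring.
move/eqP: e2; rewrite mulf_eq0 (negPf (neq0Ci _)) /= subr_eq0 => /eqP bb'.
by move/eqP: e1; rewrite -bb' -mulr2n mulrn_eq0 /= => /eqP.
Qed.

Definition form n (A : 'M[C]_n) (x y : 'cV[C]_n) : C := (hc x *m A *m y) 0 0.

Lemma formD n (A : 'M[C]_n) x y t : form A (y + t *: x) (y + t *: x) =
  form A y y + t * form A y x + t^* * form A x y + t^* * t * form A x x.
Proof.
rewrite /form hcD hcZ !(mulmxDl, mulmxDr) -!(scalemxAl, scalemxAr) !mxE !mulrA; ring.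
Qed.

Lemma form_eq0 n (A : 'M[C]_n) : (forall v, form A v v = 0) -> A = 0.
Proof.
move=> A0; apply/matrixP => i j.
have e : form A (delta_mx i 0) (delta_mx j 0) = A i j.
  rewrite /form /hc map_delta_mx trmx_delta -rowE -colE !mxE //.
rewrite -e mxE; apply: (@pencil_ge0 0 _ (form A (delta_mx j 0) (delta_mx i 0))) => t.
have := formD A (delta_mx j 0) (delta_mx i 0) t; rewrite !A0 mulr0 addr0 => <-.
by [].
Qed.

Section Fixed.
Context {d : nat}.
Implicit Types (A B G P X Y : 'M[C]_d).

Lemma psdP A : psd A <-> forall v, 0 <= form A v v.
Proof.
have E (v : 'cV[C]_d) : form A v v = \sum_i \sum_j (v i 0)^* * A i j * v j 0.
  rewrite /form mxE exchange_big; apply: eq_bigr => j _; rewrite mxE mulr_suml.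
  by apply: eq_bigr => i _; rewrite hcE.
split=> [pA v|pA v]; first by rewrite E; apply: (pA (fun i => v i 0)).
have := pA (\col_i v i); rewrite E.
by under eq_bigr => i _ do under eq_bigr => j _ do rewrite !mxE.
Qed.

Lemma formDl A B v : form (A + B) v v = form A v v + form B v v.
Proof. by rewrite /form mulmxDr mulmxDl mxE. Qed.

Lemma formZl a A v : form (a *: A) v v = a * form A v v.
Proof. by rewrite /form -scalemxAr -scalemxAl mxE. Qed.

Lemma psdD A B : psd A -> psd B -> psd (A + B).
Proof.
by move=> /psdP pA /psdP pB; apply/psdP => v; rewrite formDl addr_ge0.
Qed.

Lemma psd0 : psd (0 : 'M[C]_d).
Proof. by apply/psdP => v; rewrite /form mulmx0 mul0mx mxE. Qed.

Lemma psd_pencil A B B' : (forall t, psd (A + t *: B + t^* *: B')) -> B = 0.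
Proof.
move=> h; apply: form_eq0 => v; apply: (@pencil_ge0 (form A v v) _ (form B' v v)) => t.
by rewrite -!formZl -!formDl; have /psdP := h t.
Qed.

Lemma psd_herm A : psd A -> hc A = A.
Proof.
move=> /psdP pA; apply/eqP; rewrite -subr_eq0; apply/eqP; apply: form_eq0 => v.
have -> : form (hc A - A) v v = (form A v v)^* - form A v v.
  rewrite formDl -scaleN1r formZl mulN1r; congr (_ - _).
  by rewrite /form -[RHS]hcE !hcM hcK mulmxA.
by rewrite (conj_Creal (ger0_real (pA v))) subrr.
Qed.

Lemma psd_gram m (G : 'M[C]_(m, d)) : psd (hc G *m G).
Proof.
apply/psdP => v; rewrite /form !mulmxA -hcM -mulmxA mxE.
by rewrite sumr_ge0 // => i _; rewrite hcE -normCKC exprn_ge0.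
Qed.

Lemma psd_conj A X : psd A -> psd (hc X *m A *m X).
Proof.
move=> /psdP pA; apply/psdP => v; have := pA (X *m v).
by rewrite /form hcM !mulmxA.
Qed.

Lemma psd_proj P : hc P = P -> P *m P = P -> psd P.
Proof. by move=> Ph PP; rewrite -PP -{1}Ph; apply: psd_gram. Qed.

(** Functional calculus: if [A = fcalc U a], then [fcalc U (phi \o a)] is [phi(A)]. The weights are
    indexed by eigenvectors, not by eigenvalues. *)
Definition fcalc (U : 'M[C]_d) (g : 'I_d -> C) : 'M[C]_d :=
  hc U *m diag_mx (\row_i g i) *m U.

Lemma eq_fcalc U g h : g =1 h -> fcalc U g = fcalc U h.
Proof. by move=> gh; congr (_ *m diag_mx _ *m _); apply/rowP => i; rewrite !mxE. Qed.

Lemma fcalcM U g h : U *m hc U = 1%:M ->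
  fcalc U g *m fcalc U h = fcalc U (fun i => g i * h i).
Proof.
move=> UU; rewrite /fcalc !mulmxA -(mulmxA _ U) UU mulmx1 -(mulmxA (hc U)) mulmx_diag.
by congr (_ *m diag_mx _ *m _); apply/rowP => i; rewrite !mxE.
Qed.

Lemma fcalcB U g h : fcalc U g - fcalc U h = fcalc U (fun i => g i - h i).
Proof.
rewrite /fcalc -mulmxBl -mulmxBr -linearB.
by congr (_ *m diag_mx _ *m _); apply/rowP => i; rewrite !mxE.
Qed.

Lemma fcalcZ U a g : a *: fcalc U g = fcalc U (fun i => a * g i).
Proof.
rewrite /fcalc scalemxAl scalemxAr -linearZ.
by congr (_ *m diag_mx _ *m _); apply/rowP => i; rewrite !mxE.
Qed.

Lemma fcalc1 U : hc U *m U = 1%:M -> fcalc U (fun=> 1) = 1%:M.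
Proof.
move=> UU; rewrite /fcalc (_ : diag_mx _ = 1%:M) ?mulmx1 //.
by rewrite -diag_const_mx; congr diag_mx; apply/rowP => i; rewrite !mxE.
Qed.

Lemma hc_fcalc U g : hc (fcalc U g) = fcalc U (fun i => (g i)^*).
Proof.
rewrite /fcalc !hcM hcK mulmxA; congr (_ *m _ *m _).
rewrite /hc map_diag_mx tr_diag_mx; congr diag_mx; apply/rowP => i; by rewrite !mxE.
Qed.

Lemma fcalc_eq0 U g : U *m hc U = 1%:M -> fcalc U g = 0 -> forall i, g i = 0.
Proof.
move=> UU /(congr1 (fun X => U *m X *m hc U)); rewrite /fcalc mulmx0 mul0mx.
rewrite !mulmxA UU mul1mx -mulmxA UU mulmx1 => /matrixP e i.
by have := e i i; rewrite !mxE eqxx mulr1n.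
Qed.

Lemma hermitian_fcalc A : hc A = A -> exists U a,
  [/\ U *m hc U = 1%:M, hc U *m U = 1%:M, A = fcalc U a & forall i, a i \is Num.real].
Proof.
move=> Ah; have hcT m n (B : 'M[C]_(m, n)) : hc B = map_mx Num.conj B^T by rewrite /hc map_trmx.
have Aherm : A \is hermsymmx by apply/is_hermitianmxP; rewrite expr0 scale1r -hcT Ah.
have /hermitian_normalmx /orthomx_spectralP AE := Aherm.
have Uu := spectral_unitarymx A; have /unitarymxP := Uu.
move: AE; rewrite invmx_unitary // -!hcT => AE UU.
exists (spectralmx A), (fun i => spectral_diag A 0 i); split=> //.
- by have /mulmx1C := UU.
- by rewrite {1}AE /fcalc; congr (_ *m diag_mx _ *m _); apply/rowP => i; rewrite mxE.
- by move=> i; have /mxOverP := hermitian_spectral_diag_real Aherm; apply.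
Qed.

Lemma psd_fcalc_ge0 U a : U *m hc U = 1%:M -> psd (fcalc U a) -> forall i, 0 <= a i.
Proof.
move=> UU /psdP pA i; have := pA (hc U *m delta_mx i 0).
rewrite /form hcM hcK /fcalc !mulmxA -(mulmxA _ U) UU mulmx1.
rewrite -(mulmxA _ U) UU mulmx1 /hc map_delta_mx trmx_delta -rowE -colE.
by rewrite !mxE eqxx mulr1n.
Qed.

Lemma fcalc_psd U a : (forall i, 0 <= a i) -> psd (fcalc U a).
Proof.
move=> a0; have -> : fcalc U a = hc (diag_mx (\row_i sqrtC (a i)) *m U) *m (diag_mx (\row_i sqrtC (a i)) *m U).
  rewrite hcM !mulmxA /fcalc; congr (_ *m _); rewrite -mulmxA; congr (_ *m _).
  rewrite /hc map_diag_mx tr_diag_mx mulmx_diag; congr diag_mx; apply/rowP => i.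
  by rewrite !mxE -normCKC ger0_norm ?sqrtC_ge0 // sqrtCK.
exact: psd_gram.
Qed.

Lemma psd_spectral A : psd A -> exists U a,
  [/\ U *m hc U = 1%:M, hc U *m U = 1%:M, A = fcalc U a & forall i, 0 <= a i].
Proof.
move=> pA; have [U [a [UU UU' AE _]]] := hermitian_fcalc (psd_herm pA).
by exists U, a; split=> //; apply: psd_fcalc_ge0 UU _; rewrite -AE.
Qed.

Lemma psd_sqrt A : psd A -> exists G, A = hc G *m G.
Proof.
move=> /psd_spectral[U [a [UU _ -> a0]]]; exists (fcalc U (fun i => sqrtC (a i))).
rewrite hc_fcalc fcalcM //; apply: eq_fcalc => i.
by rewrite -normCKC ger0_norm ?sqrtC_ge0 // sqrtCK.
Qed.

Lemma psd_tr_ge0 A : psd A -> 0 <= \tr A.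
Proof.
move=> /psd_sqrt[G ->]; rewrite tr_gram.
by rewrite sumr_ge0 // => j _; rewrite sumr_ge0 // => i _; rewrite exprn_ge0.
Qed.

Lemma psd_tr_eq0 A : psd A -> \tr A = 0 -> A = 0.
Proof. by move=> /psd_sqrt[G ->] /tr_gram_eq0 ->; rewrite mulmx0. Qed.

Lemma psd_trM_ge0 A B : psd A -> psd B -> 0 <= \tr (A *m B).
Proof.
move=> /psd_sqrt[G ->] pB; rewrite -mulmxA mxtrace_mulC.
by apply: psd_tr_ge0; have := psd_conj (hc G) pB; rewrite hcK.
Qed.

Lemma psd_trM_eq0 A B : psd A -> psd B -> \tr (A *m B) = 0 -> A *m B = 0.
Proof.
move=> /psd_sqrt[G ->] /psd_sqrt[H ->]; rewrite -mulmxA mxtrace_mulC.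
have -> : G *m (hc H *m H) *m hc G = hc (H *m hc G) *m (H *m hc G).
  by rewrite hcM hcK !mulmxA.
move=> /tr_gram_eq0 /(congr1 (@hc _ _)); rewrite hcM hcK hc0 => GH.
by rewrite [G *m _]mulmxA GH mul0mx mulmx0.
Qed.

Lemma psd_antisym A : psd A -> psd (- A) -> A = 0.
Proof.
move=> pA pNA; apply: psd_tr_eq0 => //; apply/eqP; rewrite eq_le psd_tr_ge0 // andbT.
by rewrite -oppr_ge0 -linearN psd_tr_ge0.
Qed.

Lemma psd_conj_eq0 m A (X : 'M_(d, m)) : psd A -> hc X *m A *m X = 0 -> A *m X = 0.
Proof.
move=> /psd_sqrt[G ->]; rewrite mulmxA -hcM -mulmxA => /gram_eq0 e.
by rewrite -mulmxA e mulmx0.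
Qed.

End Fixed.
End Psd.

(** * Fixed points and enclosures of positive maps *)

Section PositiveMaps.
Context {C : numClosedFieldType} {d : nat}.
Implicit Types (A B G X Y Z E P Q R : 'M[C]_d) (z : C).
Notation endo := {linear 'M[C]_d -> 'M[C]_d}.

Lemma trM_inj X Y : (forall A, \tr (A *m X) = \tr (A *m Y)) -> X = Y.
Proof.
move=> e; apply/eqP; rewrite -subr_eq0; apply/eqP/tr_gram_eq0.
by rewrite mulmxBr linearB /= e subrr.
Qed.

(** Apply [f] to the Gram matrix of [A + t]: after removal of hermitian terms,
    [t f(hc A) + t^* f(A)] is hermitian, and [t = 1] and [t = i] separate the two summands. *)
Lemma positive_hc (f : endo) A : positive_map f -> f (hc A) = hc (f A).
Proof.
move=> fpos.
have f1 : hc (f 1%:M) = f 1%:M by apply/psd_herm/fpos/psd_proj; rewrite ?hc1 ?mul1mx.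
have fA : hc (f (hc A *m A)) = f (hc A *m A) by apply/psd_herm/fpos/psd_gram.
have ft t : hc (t *: f (hc A) + t^* *: f A) = t *: f (hc A) + t^* *: f A.
  have -> : t *: f (hc A) + t^* *: f A =
     f (hc (A + t%:M) *m (A + t%:M)) - f (hc A *m A) - (t^* * t) *: f 1%:M.
    have -> : hc (A + t%:M) *m (A + t%:M) =
      hc A *m A + (t *: hc A + t^* *: A) + (t^* * t) *: 1%:M.
      rewrite -scalemx1 hcD hcZ hc1 !(mulmxDl, mulmxDr) -!(scalemxAl, scalemxAr) !mul1mx !mulmx1.
      by rewrite -!addrA scalerA.
    by rewrite !(linearD, linearZ) /= scalerN addrAC addrK [f (hc A *m A) + _]addrC addrK.
  by rewrite !hcB hcZ f1 fA rmorphM /= conjCK [t * _]mulrC psd_herm //; apply/fpos/psd_gram.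
have e1 := ft 1; have e2 := ft 'i.
move: e1 e2; rewrite !(hcD, hcZ) !conjCK conjC1 !scale1r conjCi !scaleNr -!scalerBr.
move=> e1.
rewrite [X in X = _]addrC -scalerBr => /(scalerI (neq0Ci _)) e2.
have e3 : f (hc A) + f (hc A) = hc (f A) + hc (f A).
  transitivity ((f (hc A) + f A) + (f (hc A) - f A)); first by rewrite addrACA subrr addr0.
  by rewrite -e1 -e2 [hc (f (hc A)) + _]addrC addrACA subrr addr0.
have n2 : 2%:R != 0 :> C by rewrite pnatr_eq0.
by apply: (scalerI n2); rewrite !scaler_nat !mulr2n.
Qed.

(* Cauchy-Schwarz for the semidefinite form [(X, Y) |-> E f(X^* Y) E]. *)
Lemma compress_gram_eq0 (f : endo) E G Y : positive_map f ->
  hc E *m f (hc G *m G) *m E = 0 -> hc E *m f (Y *m G) *m E = 0.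
Proof.
move=> fpos EG0; rewrite -[Y]hcK.
apply: (@psd_pencil _ _ (hc E *m f (hc (hc Y) *m hc Y) *m E) _ (hc E *m f (hc G *m hc Y) *m E)) => t.
have := psd_conj E (fpos _ (psd_gram (hc Y + t *: G))).
rewrite hcD hcZ !(mulmxDl, mulmxDr) -!(scalemxAl, scalemxAr) !(linearD, linearZ) /=.
rewrite !(mulmxDl, mulmxDr) -!(scalemxAl, scalemxAr) EG0 !scaler0 addr0.
exact.
Qed.

Section Channel.
Variables T S : endo.
Hypothesis adjTS : forall A B, \tr (A *m S B) = \tr (T A *m B).
Hypothesis Tpos : positive_map T.
Hypothesis Ttr : trace_preserving T.

Lemma adjoint_unital : S 1%:M = 1%:M.
Proof. by apply: trM_inj => A; rewrite adjTS !mulmx1 Ttr. Qed.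

Lemma adjoint_positive : positive_map S.
Proof.
move=> A pA; apply/psdP => v.
have -> : form (S A) v v = \tr (hc v *m S A *m v) by rewrite /mxtrace big_ord1.
rewrite mxtrace_mulC mulmxA adjTS; apply: psd_trM_ge0 => //; apply: Tpos.
by rewrite -{1}[v]hcK; apply: psd_gram.
Qed.

Notation Spos := adjoint_positive.

Lemma T_hc A : T (hc A) = hc (T A). Proof. exact: positive_hc. Qed.
Lemma S_hc A : S (hc A) = hc (S A). Proof. exact: (positive_hc _ Spos). Qed.

Section Enclosure.
Variable E : 'M[C]_d.
Hypotheses (Eh : hc E = E) (EE : E *m E = E) (Einv : E *m S (1%:M - E) *m E = 0).

(** The projection [1 - E] is its own Gram matrix, so the vanishing of [E S(1 - E) E] spreads to all
    its left multiples. *)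
Lemma enclosure_compl_r Y : E *m S (Y *m (1%:M - E)) *m E = 0.
Proof.
rewrite -{1}Eh; apply: compress_gram_eq0 Spos _; rewrite Eh hcB hc1 Eh.
by rewrite mulmxBr mulmx1 mulmxBl mul1mx EE subrr subr0.
Qed.

Lemma enclosure_compl_l Y : E *m S ((1%:M - E) *m Y) *m E = 0.
Proof.
have := enclosure_compl_r (hc Y) => /(congr1 (@hc _ _ _)).
rewrite !hcM -S_hc hcM hcB hc1 Eh hcK hc0 mulmxA; exact.
Qed.

Lemma enclosure_compress Y : E *m S (E *m Y *m E) *m E = E *m S Y *m E.
Proof.
have YE : Y = E *m Y *m E + E *m Y *m (1%:M - E) + (1%:M - E) *m Y.
  by rewrite mulmxBr mulmxBl mulmx1 mul1mx [E *m Y *m E + _]addrC subrK addrC subrK.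
rewrite [in RHS]YE; move: (enclosure_compl_r (E *m Y)) (enclosure_compl_l Y).
move: (1%:M - E) => F r0 l0.
by rewrite !linearD /= !(mulmxDr, mulmxDl) r0 l0 !addr0.
Qed.

(** The trace dual of [enclosure_compress]; this is the sense in which [E] is an enclosure for
    [T]. *)
Lemma enclosure_stable X : T (E *m X *m E) = E *m T (E *m X *m E) *m E.
Proof.
apply: trM_inj => Y.
have F Z B : \tr (E *m Z *m E *m B) = \tr (Z *m (E *m B *m E)).
  by rewrite -!mulmxA mxtrace_mulC -!mulmxA.
rewrite mxtrace_mulC [RHS]mxtrace_mulC F -!adjTS !F.
by congr (\tr (_ *m _)); rewrite enclosure_compress.
Qed.

End Enclosure.
End Channel.
End PositiveMaps.

(** * Positive fixed points and their supports *)

Section FixedPoints.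
Context {C : numClosedFieldType} {d : nat}.
Implicit Types (A B G X Y Z E P Q R : 'M[C]_d) (z : C).
Notation endo := {linear 'M[C]_d -> 'M[C]_d}.

Variable T : endo.
Hypothesis Tpos : positive_map T.
Hypothesis Ttr : trace_preserving T.

Let ThcE A : T (hc A) = hc (T A) := T_hc Tpos A.

(* Jordan decomposition: if [X = X+ - X-] is fixed and [P+] is the support of
   [X+], then [tr X+ = tr P+ T(X+) - tr P+ T(X-) <= tr X+] forces equality. *)
Lemma fixed_parts X : hc X = X -> T X = X -> exists Xp Xm R,
  [/\ psd Xp, psd Xm, T Xp = Xp, T Xm = Xm & [/\ X = Xp - Xm, Xp = X *m R & Xm = X *m (R - 1%:M)]].
Proof.
move=> /hermitian_fcalc[U [a [UU UU' XE aR]]] TX.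
pose ap i := if 0 <= a i then a i else 0.
pose pp i : C := if 0 <= a i then 1 else 0.
pose Xp := fcalc U ap; pose R := fcalc U pp; pose Xm := fcalc U (fun i => ap i - a i).
have pXp : psd Xp by apply: fcalc_psd => i; rewrite /ap; case: ifP.
have pXm : psd Xm.
  apply: fcalc_psd => i; rewrite /ap; case: ifP => [_|]; first by rewrite subrr.
  move=> /negbT; rewrite -real_ltNge ?real0 // => /ltW; by rewrite sub0r oppr_ge0.
have pR : psd R by apply: fcalc_psd => i; rewrite /pp; case: ifP; rewrite ?ler01.
have pR' : psd (1%:M - R).
  rewrite -(fcalc1 UU') /R fcalcB; apply: fcalc_psd => i; rewrite /pp.
  by case: ifP; rewrite ?subrr ?subr0 ?ler01.
have XpR : X *m R = Xp.
  rewrite XE /R fcalcM //; apply: eq_fcalc => i; rewrite /pp /ap.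
  by case: ifP => _; rewrite ?mulr1 ?mulr0.
have Xd : X = Xp - Xm.
  by rewrite XE fcalcB; apply: eq_fcalc => i; rewrite subKr.
have RX : R *m X = Xp.
  rewrite XE /R fcalcM //; apply: eq_fcalc => i; rewrite /pp /ap.
  by case: ifP => _; rewrite ?mul1r ?mul0r.
have TXd : T Xp - T Xm = X by rewrite -linearB -Xd.
have tXp : \tr Xp = \tr (R *m T Xp) - \tr (R *m T Xm).
  by rewrite -[in LHS]RX -TXd mulmxBr linearB.
(* Both traces are non-negative; since [T] preserves the trace of [Xp], their sum vanishes. *)
have s0 : \tr ((1%:M - R) *m T Xp) + \tr (R *m T Xm) = 0.
  rewrite mulmxBl mul1mx linearB /= Ttr tXp.
  by rewrite [_ - _ - _]addrAC subrr add0r addNr.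
have p1 := psd_trM_ge0 pR' (Tpos pXp); have p2 := psd_trM_ge0 pR (Tpos pXm).
have /andP[/eqP t1 /eqP t2] : (\tr ((1%:M - R) *m T Xp) == 0) && (\tr (R *m T Xm) == 0).
  by rewrite -paddr_eq0 // s0.
have e1 := psd_trM_eq0 pR' (Tpos pXp) t1; have e2 := psd_trM_eq0 pR (Tpos pXm) t2.
have TXp : T Xp = Xp.
  rewrite -[RHS]RX -TXd mulmxBr e2 subr0.
  by move/eqP: e1; rewrite mulmxBl mul1mx subr_eq0 => /eqP.
(* Writing both parts as right multiples of [X] lets a relation [E *m X = X] pass to them. *)
exists Xp, Xm, R; split=> //; last split=> //.
  by move: TXd; rewrite TXp Xd => /addrI /oppr_inj.
by rewrite mulmxBr mulmx1 XpR Xd subKr.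
Qed.

Lemma herm_decomp X : T X = X -> exists H K,
  [/\ hc H = H, hc K = K, T H = H, T K = K & [/\ X = 2^-1 *: (H - 'i *: K) & H = X + hc X /\ K = 'i *: (X - hc X)]].
Proof.
move=> TX; exists (X + hc X), ('i *: (X - hc X)); split=> //.
- by rewrite hcD hcK addrC.
- by rewrite hcZ hcB hcK conjCi scaleNr -scalerN opprB.
- by rewrite linearD /= ThcE TX.
- by rewrite linearZ /= linearB /= ThcE TX.
split=> //; rewrite scalerA -expr2 sqrCi scaleN1r opprK addrACA subrr addr0.
by rewrite -mulr2n -scaler_nat scalerA mulVf ?scale1r // pnatr_eq0.
Qed.

(** [Z A Z] and [Z B Z] are positive with sum zero, so each of them vanishes. *)
Lemma psd_add_annihil A B Z : psd A -> psd B -> hc Z = Z -> Z *m (A + B) = 0 ->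
  Z *m A = 0 /\ Z *m B = 0.
Proof.
have half A' B' : psd A' -> psd B' -> hc Z = Z -> Z *m (A' + B') = 0 -> Z *m A' = 0.
  move=> pA pB Zh; rewrite mulmxDr => /(congr1 (mulmx^~ Z)); rewrite mul0mx mulmxDl.
  move=> /eqP; rewrite addr_eq0 => /eqP e.
  have pZA : psd (Z *m A' *m Z) by rewrite -{1}Zh; apply: psd_conj.
  have pZB : psd (Z *m B' *m Z) by rewrite -{1}Zh; apply: psd_conj.
  have ZAZ : hc Z *m A' *m Z = 0.
    by rewrite Zh; apply: psd_antisym => //; rewrite e opprK.
  by have /(congr1 (@hc _ _ _)) := psd_conj_eq0 pA ZAZ; rewrite hcM Zh psd_herm // hc0.
move=> pA pB Zh e; split; [exact: half pB Zh e | apply: half pA Zh _ => //].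
by rewrite addrC.
Qed.

(** Domination is expressed by annihilators: the range of [X] lies in that of [rho]. The sum of the
    positive and negative parts of the two hermitian components achieves it. *)
Lemma fixed_dominated X : T X = X ->
  exists2 rho, psd rho /\ T rho = rho & forall Z, hc Z = Z -> Z *m rho = 0 -> Z *m X = 0.
Proof.
move=> /herm_decomp[H [K [Hh Kh TH TK [-> _]]]].
have [Hp [Hm [_ [pHp pHm THp THm [-> _ _]]]]] := fixed_parts Hh TH.
have [Kp [Km [_ [pKp pKm TKp TKm [-> _ _]]]]] := fixed_parts Kh TK.
have p1 := psdD pHp pHm; have p2 := psdD pKp pKm.
exists (Hp + Hm + (Kp + Km)).
  by split; [exact: psdD | rewrite !linearD /= THp THm TKp TKm].
move=> Z Zh /(psd_add_annihil p1 p2 Zh)[/(psd_add_annihil pHp pHm Zh)[h1 h2]].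
move=> /(psd_add_annihil pKp pKm Zh)[h3 h4].
by rewrite -scalemxAr mulmxBr -scalemxAr !mulmxBr h1 h2 h3 h4 !subr0 scaler0 subr0 scaler0.
Qed.

(** The fixed space has a finite spanning family, so a finite sum of dominating matrices works and
    no supremum is taken. *)
Lemma maximal_fixed : exists2 rho, psd rho /\ T rho = rho &
  forall X, T X = X -> forall Z, hc Z = Z -> Z *m rho = 0 -> Z *m X = 0.
Proof.
suff [rho rhoP dom] : exists2 rho, psd rho /\ T rho = rho & forall i, forall Z, hc Z = Z ->
    Z *m rho = 0 -> Z *m vec_mx (row i (eigenspace (lin_mx T) 1)) = 0.
  exists rho => // X TX Z Zh Zr.
  have /submxP[u uE] : (mxvec X <= eigenspace (lin_mx T) 1)%MS.
    by rewrite mxvec_eigenspace scale1r TX.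
  rewrite -[X]mxvecK uE mulmx_sum_row linear_sum mulmx_sumr big1 // => i _.
  by rewrite linearZ /= -scalemxAr dom // scaler0.
suff H (s : seq 'M[C]_d) : (forall X, X \in s -> T X = X) ->
    exists2 rho, psd rho /\ T rho = rho & forall X, X \in s -> forall Z, hc Z = Z ->
    Z *m rho = 0 -> Z *m X = 0.
  have [|rho rhoP dom] := H [seq vec_mx (row i (eigenspace (lin_mx T) 1)) | i : 'I_(d * d)].
    move=> X /mapP[i _ ->]; have := row_sub i (eigenspace (lin_mx T) 1).
    by rewrite -[row i _]vec_mxK mxvec_eigenspace scale1r mxvecK => /eqP.
  by exists rho => // i; apply: dom; apply: map_f; rewrite mem_enum.
elim: s => [|X s IH] sT; first by exists 0 => //; split; [exact: psd0 | exact: linear0].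
have [rho [pr Tr] dom] := IH (fun Y Ys => sT Y (mem_behead (s := X :: s) Ys)).
have [sg [ps Ts] domX] := fixed_dominated (sT X (mem_head _ _)).
exists (rho + sg); first by split; [exact: psdD | rewrite linearD /= Tr Ts].
move=> Y; rewrite inE => /predU1P[->|Ys] Z Zh /(psd_add_annihil pr ps Zh)[Zr Zs].
  exact: domX.
exact: dom.
Qed.

End FixedPoints.

(** * Invariant projections and superharmonic matrices *)

Section Reduction.
Context {C : numClosedFieldType} {d : nat}.
Implicit Types (A B G X Y Z E P Q R : 'M[C]_d) (z : C).
Notation endo := {linear 'M[C]_d -> 'M[C]_d}.

Variables T S : endo.
Hypothesis adjTS : forall A B, \tr (A *m S B) = \tr (T A *m B).
Hypothesis Tpos : positive_map T.
Hypothesis Ttr : trace_preserving T.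

Let Spos : positive_map S := adjoint_positive adjTS Tpos.
Let S1 : S 1%:M = 1%:M := adjoint_unital adjTS Ttr.

Definition compression P (f : endo) : endo := mulmxr P \o (mulmx P \o f).
Definition cocompression P (f : endo) : endo := f \o (mulmxr P \o mulmx P).

Lemma compressionE P f X : compression P f X = P *m f X *m P. Proof. by []. Qed.
Lemma cocompressionE P f X : cocompression P f X = f (P *m X *m P). Proof. by []. Qed.

Lemma compression_adjoint P A B :
  \tr (A *m compression P S B) = \tr (cocompression P T A *m B).
Proof. by rewrite compressionE cocompressionE -adjTS -!mulmxA [RHS]mxtrace_mulC -!mulmxA. Qed.

(** [E] is fixed by [E S(.) E], so 1 is also an eigenvalue of the adjoint [T(E . E)], and the
    eigenvector is a fixed point of [T] in the corner of [E]. This takes the place of an ergodic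
    mean. *)
Lemma enclosure_fixed E : hc E = E -> E *m E = E -> E != 0 ->
  E *m S (1%:M - E) *m E = 0 ->
  exists sg, [/\ psd sg, sg != 0, T sg = sg & E *m sg = sg].
Proof.
move=> Eh EE E0 Einv.
have : (0 < gdim (cocompression E T) 1)%N.
  rewrite (gdim_adjoint _ (compression_adjoint E)); apply/gdim_gt0P; exists E => //.
  have SE : S E = 1%:M - S (1%:M - E) by rewrite linearB /= S1 subKr.
  by rewrite compressionE SE mulmxBr mulmxBl Einv subr0 mulmx1 EE scale1r.
case/gdim_gt0P => X; rewrite scale1r cocompressionE => XE X0.
have XE' : X = E *m X *m E.
  by rewrite -[in LHS]XE (enclosure_stable adjTS Tpos Eh EE Einv) XE.
have TX : T X = X by rewrite {1}XE' XE.
have EX : E *m X = X by rewrite XE' !mulmxA EE.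
have XEr : X *m E = X by rewrite XE' -(mulmxA (E *m X)) EE.
have EhX : E *m hc X = hc X by rewrite -{1}Eh -hcM XEr.
have [H [K [Hh Kh TH TK [Xd [HE KE]]]]] := herm_decomp Tpos TX.
have EH : E *m H = H by rewrite HE mulmxDr EX EhX.
have EK : E *m K = K by rewrite KE -scalemxAr mulmxBr EX EhX.
have [Y [Yh TY EY Y0]] : exists Y, [/\ hc Y = Y, T Y = Y, E *m Y = Y & Y != 0].
  have [H0|H0] := eqVneq H 0; last by exists H.
  exists K; split=> //; apply: contra X0 => /eqP K0.
  by rewrite Xd H0 K0 scaler0 subr0 scaler0.
have [Yp [Ym [R [pYp pYm TYp TYm [Yd YpR YmR]]]]] := fixed_parts Tpos Ttr Yh TY.
have [Yp0|Yp0] := eqVneq Yp 0; last first.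
  by exists Yp; split=> //; rewrite YpR mulmxA EY.
exists Ym; split=> //; last by rewrite YmR mulmxA EY.
by apply: contra Y0 => /eqP Ym0; rewrite Yd Yp0 Ym0 subr0.
Qed.

(* The eigenprojection [E] of [X] for its largest eigenvalue [m] satisfies
   [m E = E X E <= E S(X) E <= m E S(1) E = m E], hence is invariant. *)
Lemma superharmonic_eq0 Q X :
  (forall sg, psd sg -> T sg = sg -> Q *m sg = sg -> sg = 0) ->
  psd X -> Q *m X = X -> psd (S X - X) -> X = 0.
Proof.
move=> noQ pX QX pSX; apply/eqP; apply: contraT => X0.
have [U [a [UU UU' XE a0]]] := psd_spectral pX.
have [i0 ai0] : exists i, a i != 0.
  apply/existsP; apply: contraR X0; rewrite negb_exists => /forallP az.
  rewrite XE (eq_fcalc _ (h := fun i => 0 * a i)) -?fcalcZ ?scale0r // => i.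
  by rewrite mul0r; apply/eqP; have := az i; rewrite negbK.
case: (@real_arg_maxP C 'I_d i0 xpredT a isT) => [i _|i1 _ amax]; first exact: ger0_real.
set m := a i1 in amax.
have m0 : 0 < m.
  by apply: lt_le_trans (amax i0 isT); rewrite lt_def ai0 a0.
pose e i : C := if a i == m then 1 else 0; pose E := fcalc U e.
have Eh : hc E = E.
  by rewrite hc_fcalc; apply: eq_fcalc => i; rewrite /e; case: ifP; rewrite ?conjC0 ?conjC1.
have EE : E *m E = E.
  by rewrite fcalcM //; apply: eq_fcalc => i; rewrite /e; case: ifP; rewrite ?mulr1 ?mulr0.
have E0 : E != 0.
  apply/eqP => /(fcalc_eq0 UU)/(_ i1); rewrite /e eqxx => /eqP; by rewrite oner_eq0.
have EX : E *m X = m *: E.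
  rewrite XE fcalcM // fcalcZ; apply: eq_fcalc => i; rewrite /e.
  by case: eqP => [->|_]; rewrite ?mulr1 ?mul1r ?mul0r ?mulr0.
have XEm : X *m E = m *: E.
  by rewrite -[X]psd_herm // -{1}Eh -hcM EX hcZ Eh conj_Creal // gtr0_real.
have mX : m *: 1%:M - X = fcalc U (fun i => m - a i).
  rewrite -(fcalc1 UU') fcalcZ XE fcalcB; apply: eq_fcalc => i; by rewrite mulr1.
have pmX : psd (m *: 1%:M - X).
  by rewrite mX; apply: fcalc_psd => i; rewrite subr_ge0; apply: amax.
(* This exhibits [1 - E] as a left multiple of [m - X], the shape that [compress_gram_eq0] handles.
   Where [a i = m] the inverse is multiplied by 0, so its value does not matter. *)
have E1 : 1%:M - E = fcalc U (fun i => (m - a i)^-1) *m (m *: 1%:M - X).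
  rewrite mX fcalcM // -(fcalc1 UU') fcalcB; apply: eq_fcalc => i; rewrite /e.
  have [->|ne] := eqVneq (a i) m; first by rewrite !subrr mulr0.
  by rewrite subr0 mulVf // subr_eq0 eq_sym.
have SmX0 : E *m S (m *: 1%:M - X) *m E = 0.
  apply: psd_antisym; first by rewrite -{1}Eh; apply: psd_conj; apply: Spos.
  have -> : - (E *m S (m *: 1%:M - X) *m E) = hc E *m (S X - X) *m E.
    rewrite Eh linearB linearZ /= S1 !(mulmxBr, mulmxBl) EX.
    by rewrite opprB -!scalemxAr -!scalemxAl mulmx1 EE.
  exact: psd_conj.
have [G GE] := psd_sqrt pmX.
have Einv : E *m S (1%:M - E) *m E = 0.
  rewrite E1 GE mulmxA -{1}Eh; apply: (compress_gram_eq0 _ Spos).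
  by rewrite Eh -GE.
have [sg [psg sg0 Tsg Esg]] := enclosure_fixed Eh EE E0 Einv.
have QE : Q *m E = E.
  have EmX : E = m^-1 *: (X *m E) by rewrite XEm scalerA mulVf ?scale1r ?gt_eqF.
  by rewrite EmX -scalemxAr mulmxA QX.
by move: sg0; rewrite (noQ sg) ?eqxx // -Esg mulmxA QE.
Qed.

End Reduction.

(** * The recurrent corner *)

Section Peripheral.
Context {C : numClosedFieldType} {d : nat}.
Implicit Types (A B G X Y Z E P Q R : 'M[C]_d) (z : C).
Notation endo := {linear 'M[C]_d -> 'M[C]_d}.

(** The interface between analysis and algebra: the decomposition into minimal projections works
    from these properties alone. [corner_mul] places peripheral eigenvectors in the multiplicative
    domain of [f]. *)
Record graded_corner P (f : endo) : Prop := GradedCorner {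
  corner_herm : hc P = P;
  corner_idem : P *m P = P;
  corner_unit : f P = P;
  corner_sub : forall z X, `|z| = 1 -> f X = z *: X -> P *m X = X;
  corner_hc : forall X, f (hc X) = hc (f X);
  corner_mul : forall z X Y, `|z| = 1 -> f X = z *: X -> f (Y *m X) = z *: (f Y *m X) }.

Variables T S : endo.
Hypothesis adjTS : forall A B, \tr (A *m S B) = \tr (T A *m B).
Hypothesis Tpos : positive_map T.
Hypothesis Ttr : trace_preserving T.
Hypothesis Sschwarz : forall A, psd (S (hc A *m A) - S (hc A) *m S A).

Let Spos : positive_map S := adjoint_positive adjTS Tpos.
Let ShcE A : S (hc A) = hc (S A) := S_hc adjTS Tpos A.
Let S1 : S 1%:M = 1%:M := adjoint_unital adjTS Ttr.

Lemma schwarz_hc A : psd (S (A *m hc A) - S A *m hc (S A)).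
Proof. by have := Sschwarz (hc A); rewrite hcK -ShcE. Qed.

Lemma unit_conj z : `|z| = 1 -> z^* * z = 1.
Proof. by rewrite -normCKC => ->; rewrite expr1n. Qed.

(** [R] is a pseudo-inverse of [rho]; the factorization [P = R *m rho] later turns [rho *m Y = 0]
    into [P *m Y = 0]. *)
Lemma fixed_support : exists P rho R, [/\ hc P = P, P *m P = P, psd rho /\ T rho = rho,
  P = R *m rho /\ P *m rho = rho & forall X, T X = X -> P *m X = X].
Proof.
have [rho [pr Tr] dom] := maximal_fixed Tpos Ttr.
have [U [a [UU UU' rE a0]]] := psd_spectral pr.
pose P := fcalc U (fun i => if a i == 0 then 0 else 1).
have Ph : hc P = P.
  by rewrite hc_fcalc; apply: eq_fcalc => i; case: ifP; rewrite ?conjC0 ?conjC1.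
have PP : P *m P = P.
  by rewrite fcalcM //; apply: eq_fcalc => i; case: ifP; rewrite ?mulr1 ?mulr0.
have Pr : P *m rho = rho.
  by rewrite rE fcalcM //; apply: eq_fcalc => i; case: eqP => [->|]; rewrite ?mul1r ?mulr0.
exists P, rho, (fcalc U (fun i => (a i)^-1)); split=> //.
  split=> //; rewrite rE fcalcM //; apply: eq_fcalc => i.
  by case: eqP => [->|/eqP ne]; rewrite ?mulr0 ?mulVf.
move=> X TX; have := dom X TX (1%:M - P).
rewrite hcB hc1 Ph !mulmxBl !mul1mx Pr subrr => /(_ erefl erefl) /eqP.
by rewrite subr_eq0 => /eqP <-.
Qed.

Section Corner.
Variables P rho R : 'M[C]_d.
Hypotheses (Ph : hc P = P) (PP : P *m P = P) (prho : psd rho) (Trho : T rho = rho).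
Hypotheses (PR : P = R *m rho) (Prho : P *m rho = rho).
Hypothesis Pfix : forall X, T X = X -> P *m X = X.
Let Q := 1%:M - P.
Let S' := compression P S.

Let Qh : hc Q = Q. Proof. by rewrite hcB hc1 Ph. Qed.
Let QQ : Q *m Q = Q.
Proof. by rewrite /Q mulmxBl !mulmxBr !mulmx1 !mul1mx PP subrr subr0. Qed.
Let QP : Q *m P = 0. Proof. by rewrite mulmxBl mul1mx PP subrr. Qed.
Let PDQ : P + Q = 1%:M. Proof. by rewrite addrC subrK. Qed.
Let rhoP : rho *m P = rho.
Proof. by rewrite -{1}(psd_herm prho) -{1}Ph -hcM Prho psd_herm. Qed.

Lemma PSQ : P *m S Q = 0.
Proof.
have pQ : psd Q by apply: psd_proj.
have t0 : \tr (rho *m S Q) = 0.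
  by rewrite adjTS Trho -Prho mxtrace_mulC mulmxA QP mul0mx mxtrace0.
by rewrite PR -mulmxA (psd_trM_eq0 prho (Spos pQ) t0) mulmx0.
Qed.

Let Pinv : P *m S (1%:M - P) *m P = 0. Proof. by rewrite PSQ mul0mx. Qed.

(** The Schwarz inequality bounds the Gram matrix of [hc (P S(Q Y))] by [P S(Q Y hc(Y) Q) P], which
    is zero. *)
Lemma PSQ_l Y : P *m S (Q *m Y) = 0.
Proof.
have e : P *m (S (Q *m Y) *m hc (S (Q *m Y))) *m P = 0.
  apply: psd_antisym; first by rewrite -{1}Ph -{1}[S _]hcK; apply/psd_conj/psd_gram.
  have := psd_conj P (schwarz_hc (Q *m Y)); rewrite Ph mulmxBr mulmxBl.
  by rewrite -(mulmxA Q) (enclosure_compl_l adjTS Tpos Ph PP Pinv) sub0r.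
have := @gram_eq0 C d d (hc (P *m S (Q *m Y))); rewrite hcK hcM Ph => H.
by apply: (can_inj (@hcK _ _ _)); rewrite hc0 hcM Ph H // !mulmxA -[_ *m hc _]mulmxA.
Qed.

Lemma PSQ_r Y : S (Y *m Q) *m P = 0.
Proof.
apply: (can_inj (@hcK _ _ _)); rewrite hc0 hcM Ph -ShcE hcM Qh; exact: PSQ_l.
Qed.

Lemma transient_superharmonic X : psd X -> Q *m X = X -> psd (S X - X) -> X = 0.
Proof.
apply: (superharmonic_eq0 adjTS Tpos Ttr) => sg _ Tsg Qsg.
by rewrite -Qsg -(Pfix Tsg) mulmxA QP mul0mx.
Qed.

(** Once [P X P = 0], the Gram matrix of [P X Q], and then [X hc(X)] for [X = Q X], is superharmonic
    and supported on [Q], hence zero. So compression to the corner loses no peripheral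
    eigenvector. *)
Lemma peripheral_transient z X : `|z| = 1 -> S X = z *: X -> P *m X *m P = 0 -> X = 0.
Proof.
move=> z1 SX PXP; have zz := unit_conj z1.
have dom A : z *: A = P *m S A -> A *m Q = A -> A = 0.
  move=> zA AQ; apply: gram_eq0; apply: transient_superharmonic.
  - exact: psd_gram.
  - by rewrite mulmxA -{1}Qh -hcM AQ.
  - have AA : hc A *m A = hc (S A) *m P *m S A.
      rewrite -[hc A *m A]scale1r -zz -scalerA scalemxAr zA scalemxAl -hcZ zA hcM Ph.
      by rewrite !mulmxA -(mulmxA _ P P) PP.
    rewrite {2}AA.
    have -> : S (hc A *m A) - hc (S A) *m P *m S A =
       (S (hc A *m A) - S (hc A) *m S A) + hc (Q *m S A) *m (Q *m S A).
      rewrite ShcE hcM Qh mulmxA -(mulmxA _ Q Q) QQ /Q mulmxBr mulmx1 mulmxBl.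
      by rewrite addrA subrK.
    by apply: psdD; [exact: Sschwarz | exact: psd_gram].
have XE : X = P *m X *m P + P *m X *m Q + Q *m X.
  by rewrite -mulmxDr PDQ mulmx1 -mulmxDl PDQ mul1mx.
have PXQ : P *m X *m Q = 0.
  apply: dom; last by rewrite -mulmxA QQ.
  (* [PSQ_r] restores the factor [Q] on the right and [PSQ_l] lets [Q X] be added under [S], so
     [P X Q] inherits the eigenvalue equation up to a left factor [P]. *)
  have SPXQ : P *m S (P *m X *m Q) = P *m S (P *m X *m Q) *m Q.
    by rewrite -{1}[P *m S _]mulmx1 -PDQ mulmxDr -[P *m S _ *m P]mulmxA PSQ_r mulmx0 add0r.
  rewrite SPXQ -[P *m S (P *m X *m Q)]addr0 -(PSQ_l X) -mulmxDr -linearD /=.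
  by rewrite -[P *m X *m Q + _]add0r -PXP addrA -XE SX -scalemxAr -scalemxAl.
have QX : Q *m X = X by rewrite {2}XE PXP PXQ !add0r.
apply: (can_inj (@hcK _ _ _)); rewrite hc0; apply: gram_eq0; rewrite hcK.
apply: transient_superharmonic.
- by rewrite -{1}[X]hcK; apply: psd_gram.
- by rewrite mulmxA QX.
- have {2}-> : X *m hc X = S X *m hc (S X).
    by rewrite SX hcZ -scalemxAl -scalemxAr scalerA mulrC zz scale1r.
  exact: schwarz_hc.
Qed.

Lemma corner_compress X : S' X = P *m S (P *m X *m P) *m P.
Proof. by rewrite (enclosure_compress adjTS Tpos Ph PP Pinv). Qed.

Lemma corner_eig z X : `|z| = 1 -> S' X = z *: X -> P *m X = X /\ X *m P = X.
Proof.
move=> z1; rewrite /S' compressionE => SX; have zz := unit_conj z1.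
have XE : X = z^* *: (P *m S X *m P) by rewrite SX scalerA zz scale1r.
split; rewrite XE -?scalemxAr -?scalemxAl.
  by rewrite !mulmxA PP.
by rewrite -[_ *m P *m P]mulmxA PP.
Qed.

(** Sesquilinear defect of the Schwarz inequality; its vanishing means multiplicativity. *)
Definition defect A B := S' (hc A *m B) - hc (S' A) *m S' B.

Let S'D A B : S' (A + B) = S' A + S' B. Proof. exact: linearD. Qed.
Let S'Z a A : S' (a *: A) = a *: S' A. Proof. exact: linearZ. Qed.

Lemma defectDl A B Z : defect (A + B) Z = defect A Z + defect B Z.
Proof. by rewrite /defect hcD mulmxDl !S'D hcD mulmxDl opprD addrACA. Qed.

Lemma defectDr A B Z : defect Z (A + B) = defect Z A + defect Z B.
Proof. by rewrite /defect mulmxDr !S'D mulmxDr opprD addrACA. Qed.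

Lemma defectZl a A B : defect (a *: A) B = a^* *: defect A B.
Proof. by rewrite /defect hcZ -scalemxAl !S'Z hcZ -scalemxAl scalerBr. Qed.

Lemma defectZr a A B : defect A (a *: B) = a *: defect A B.
Proof. by rewrite /defect -scalemxAr !S'Z -scalemxAr scalerBr. Qed.

(** Compression drops the Gram matrix of [Q S(A) P] from the subtracted product, which only enlarges
    the defect. *)
Lemma defect_psd A : psd (defect A A).
Proof.
have -> : defect A A = hc P *m (S (hc A *m A) - S (hc A) *m S A) *m P
    + hc (Q *m S A *m P) *m (Q *m S A *m P).
  rewrite /defect /S' !compressionE ShcE !hcM Qh Ph mulmxBr mulmxBl -!mulmxA.
  rewrite (mulmxA P P) PP (mulmxA Q Q) QQ -addrA; congr (_ + _).
  rewrite -[in X in _ = - X + _](mul1mx (S A *m P)) -PDQ mulmxDl !mulmxDr opprD subrK.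
  by [].
by apply: psdD; [apply: psd_conj; exact: Sschwarz | exact: psd_gram].
Qed.

Lemma rho_corner Y : \tr (rho *m S' Y) = \tr (rho *m Y).
Proof.
by rewrite /S' compressionE !mulmxA rhoP mxtrace_mulC mulmxA Prho adjTS Trho.
Qed.

Lemma rho_faithful Y : psd Y -> P *m Y = Y -> \tr (rho *m Y) = 0 -> Y = 0.
Proof.
by move=> pY PY /(psd_trM_eq0 prho pY) rY; rewrite -PY PR -mulmxA rY mulmx0.
Qed.

Lemma corner_hcE X : S' (hc X) = hc (S' X).
Proof. by rewrite /S' !compressionE ShcE !hcM Ph mulmxA. Qed.

(** As [|z| = 1], [hc (S' X) (S' X) = hc X X], so invariance of [rho] makes the [rho]-trace of the
    defect of [X] zero and faithfulness kills it; the pencil in [t] carries this to mixed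
    defects. *)
Lemma defect_eig0 z X Y : `|z| = 1 -> S' X = z *: X -> defect Y X = 0.
Proof.
move=> z1 SX; have zz := unit_conj z1.
have [PX XP] := corner_eig z1 SX.
have D0 : defect X X = 0.
  apply: rho_faithful; first exact: defect_psd.
    by rewrite /defect mulmxBr -corner_hcE /S' !compressionE !mulmxA PP.
  have e : hc (S' X) *m S' X = hc X *m X.
    by rewrite SX hcZ -scalemxAl -scalemxAr scalerA zz scale1r.
  by rewrite /defect e mulmxBr; apply/eqP; rewrite linearB subr_eq0; apply/eqP/rho_corner.
apply: (@psd_pencil _ _ (defect Y Y) _ (defect X Y)) => t.
have := defect_psd (Y + t *: X).
suff -> : defect (Y + t *: X) (Y + t *: X) =
  defect Y Y + t *: defect Y X + t^* *: defect X Y + (t^* * t) *: defect X X.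
  by rewrite D0 scaler0 addr0.
by rewrite defectDl !defectDr !defectZl !defectZr !scalerA !addrA.
Qed.

Lemma corner_mult z X Y : `|z| = 1 -> S' X = z *: X -> S' (Y *m X) = z *: (S' Y *m X).
Proof.
move=> z1 SX; have /eqP := defect_eig0 (hc Y) z1 SX.
by rewrite /defect corner_hcE !hcK subr_eq0 SX -scalemxAr => /eqP.
Qed.

Lemma corner_unitE : S' P = P.
Proof.
have -> : P = 1%:M - Q by rewrite subKr.
by rewrite /S' compressionE linearB /= S1 mulmxBr PSQ subr0 mulmx1 subKr PP.
Qed.

Lemma corner_graded : graded_corner P S'.
Proof.
split=> //; first exact: corner_unitE.
- by move=> z X z1 /(corner_eig z1)[].
- exact: corner_hcE.
- by move=> z X Y z1; apply: corner_mult.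
Qed.

Lemma corner_jordan z X Y : `|z| = 1 -> S Y = z *: Y -> S X = z *: X + Y -> Y = 0.
Proof.
move=> z1 SY SX; apply: (peripheral_transient z1 SY).
set Y' := P *m Y *m P; set X' := P *m X *m P.
have SY' : S' Y' = z *: Y'.
  by rewrite /S' compressionE -corner_compress /S' compressionE SY -scalemxAr -scalemxAl.
have SX' : S' X' = z *: X' + Y'.
  by rewrite /S' compressionE -corner_compress /S' compressionE SX mulmxDr mulmxDl -scalemxAr -scalemxAl.
have [PY' Y'P] := corner_eig z1 SY'; have zz := unit_conj z1.
apply: gram_eq0; apply: rho_faithful; first exact: psd_gram.
  by rewrite mulmxA -{1}Ph -hcM Y'P.
(* Multiplicativity gives [S'(hc X' Y') = hc X' Y' + z hc Y' Y']; invariance under [rho] leaves only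
   the last term, which excludes a Jordan block without bounding powers. *)
have := rho_corner (hc X' *m Y'); rewrite (corner_mult _ z1 SY') corner_hcE SX' hcD hcZ.
rewrite mulmxDl scalerDr -scalemxAl scalerA [z * _]mulrC zz scale1r mulmxDr raddfD /=.
move/(canRL (addKr _)); rewrite addNr -scalemxAr linearZ /= => /eqP.
rewrite mulf_eq0 => /orP[/eqP z0|/eqP //].
by move: z1 => /eqP; rewrite z0 normr0 eq_sym oner_eq0.
Qed.

Lemma corner_mult_eq z : `|z| = 1 -> mup z (char_poly (lin_mx T)) = gdim S' z.
Proof.
move=> z1; rewrite (char_poly_adjoint adjTS) eig_mult_semisimple; last first.
  by move=> X Y; apply: corner_jordan.
pose comp : endo := mulmxr P \o mulmx P.
apply/eqP; rewrite eqn_leq (@gdim_le _ _ S S' comp) /=; first last.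
- by move=> X; apply: peripheral_transient.
- move=> X SX; have := corner_compress X; rewrite /S' !compressionE => <-.
  by rewrite SX -scalemxAr -scalemxAl.
(* The reverse inequality is read on the adjoint side: an eigenvector of [T(P . P)] lies in the
   corner, so it is one of [T]. *)
rewrite -(gdim_adjoint z (compression_adjoint adjTS P)) -(gdim_adjoint z adjTS).
apply: (@gdim_le _ _ _ _ (idfun : endo)) => // X.
rewrite cocompressionE => TX; have zz := unit_conj z1.
have XE : X = z^* *: T (P *m X *m P) by rewrite TX scalerA zz scale1r.
have PXP : P *m X *m P = X.
  rewrite XE -scalemxAr -scalemxAl; congr (_ *: _).
  by rewrite -(enclosure_stable adjTS Tpos Ph PP Pinv).
by rewrite -[in LHS]PXP.
Qed.

End Corner.

Theorem peripheral_corner : exists P (f : endo), graded_corner P f /\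
  forall z, `|z| = 1 -> mup z (char_poly (lin_mx T)) = gdim f z.
Proof.
have [P [rho [R [Ph PP [pr Tr] [PR Pr] Pfix]]]] := fixed_support.
exists P, (compression P S); split.
  exact: (corner_graded Ph PP pr Tr PR Pr).
move=> z z1; exact: (corner_mult_eq Ph PP pr Tr PR Pr Pfix z1).
Qed.

End Peripheral.

(** * Minimal projections of the fixed algebra *)

Section Idempotents.
Context {C : numClosedFieldType} {d : nat}.
Implicit Types (e : 'M[C]_d).

(** Identifies the corner of [e] with matrices of size [r]; this gives its trace and a
    Cayley-Hamilton relation of degree [r]. *)
Lemma idem_factor e : e *m e = e -> exists r (K : 'M[C]_(d, r)) (L : 'M[C]_(r, d)),
  [/\ e = K *m L, L *m K = 1%:M & r = \rank e].
Proof.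
move=> ee; exists (\rank e), (col_base e), (row_base e).
move: (col_base e) (row_base e) (mulmx_base e) (row_base_free e) (col_base_full e).
move: (\rank e) => r K L KL Lf Kf; split=> //.
apply: (row_free_inj Lf); apply: (row_full_inj Kf).
by rewrite mul1mx !mulmxA KL -mulmxA KL.
Qed.

Lemma idem_trace e : e *m e = e -> \tr e = (\rank e)%:R.
Proof.
move=> ee; have [r [K [L [eE LK <-]]]] := idem_factor ee.
by rewrite eE mxtrace_mulC LK mxtrace1.
Qed.

End Idempotents.

Section Independence.
Context {F : fieldType} {V : lmodType F}.

Lemma eigen_sum_eq0 (f : {linear V -> V}) k (z : nat -> F) (x : nat -> V) :
  (forall i j, (i < k)%N -> (j < k)%N -> z i = z j -> i = j) ->
  (forall i, (i < k)%N -> f (x i) = z i *: x i) ->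
  \sum_(i < k) x i = 0 -> forall i, (i < k)%N -> x i = 0.
Proof.
elim: k x => [//|k IH] x zinj fx; rewrite big_ord_recr /= => s0.
have zinj' i j : (i < k)%N -> (j < k)%N -> z i = z j -> i = j.
  by move=> ik jk; apply: zinj; apply: ltnW.
have x0 i : (i < k)%N -> x i = 0.
  move=> ik; have zi0 : z i - z k != 0.
    rewrite subr_eq0; apply/eqP => e.
    by have e' := zinj _ _ (ltnW ik) (ltnSn k) e; rewrite e' ltnn in ik.
  apply: (scalerI zi0); rewrite scaler0.
  apply: (IH (fun i => (z i - z k) *: x i) zinj' _ _ i ik) => [j jk|].
    by rewrite linearZ /= fx ?scalerA 1?mulrC // ltnW.
  have := congr1 (fun v => f v - z k *: v) s0.
  rewrite linear0 scaler0 subr0 => e0; rewrite -[RHS]e0 linearD linear_sum scalerDr scaler_sumr /=.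
  rewrite fx // opprD addrACA subrr addr0 -sumrB; apply: eq_bigr => j _.
  by rewrite fx ?scalerBl // (ltn_trans (ltn_ord j)).
move=> i; rewrite ltnS leq_eqVlt => /predU1P[->|]; last exact: x0.
by move: s0; rewrite big1 ?add0r // => j _; apply: x0.
Qed.

End Independence.

Section RankSum.
Context {F : fieldType}.

Lemma rank_orthogonal_sum (I : finType) m n (A : 'M[F]_(m, n)) (B : I -> 'M[F]_n) :
  A *m (\sum_i B i) = A -> (forall i j, B i *m B j = if i == j then B i else 0) ->
  (forall i, (A *m B i <= A)%MS) -> \rank A = (\sum_i \rank (A *m B i))%N.
Proof.
move=> AB BB AS; have sAB : (A :=: \sum_i <<A *m B i>>)%MS.
  apply/eqmxP/andP; split; last by apply/sumsmx_subP => i _; rewrite genmxE.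
  rewrite -{1}AB mulmx_sumr; apply: summx_sub_sums => i _; by rewrite genmxE.
have dx : mxdirect (\sum_i <<A *m B i>>%MS).
  apply/mxdirect_sumsP => i _; apply/eqP/rowV0P => v; rewrite sub_capmx genmxE.
  case/andP => /submxP[u ->] /sub_sumsmxP[w wE].
  have : u *m (A *m B i) *m B i = 0.
    rewrite wE mulmx_suml big1 // => j ji.
    have /submxP[t ->] : (w j *m <<A *m B j>> <= A *m B j)%MS.
      by apply: submx_trans (submxMl _ _) _; rewrite genmxE.
    by rewrite -!mulmxA BB (negPf ji) !mulmx0.
  by rewrite -!mulmxA BB eqxx.
rewrite sAB (mxdirectP dx) /=; apply: eq_bigr => i _; by rewrite genmxE.
Qed.

End RankSum.

(** * The algebra of fixed matrices *)

Section Graded.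
Context {C : numClosedFieldType} {d : nat}.
Implicit Types (e g h x y : 'M[C]_d) (z w : C).
Notation endo := {linear 'M[C]_d -> 'M[C]_d}.
Variables (P : 'M[C]_d) (f : endo).
Hypothesis fP : graded_corner P f.

Let mulE z x y : `|z| = 1 -> f x = z *: x -> f (y *m x) = z *: (f y *m x).
Proof. exact: (corner_mul fP). Qed.

Lemma graded_mul z w x y : `|z| = 1 -> `|w| = 1 -> f x = z *: x -> f y = w *: y ->
  f (x *m y) = (z * w) *: (x *m y).
Proof.
by move=> z1 w1 fx fy; rewrite (mulE _ w1 fy) fx -scalemxAl scalerA mulrC.
Qed.

Lemma graded_hc z x : f x = z *: x -> f (hc x) = z^* *: hc x.
Proof. by move=> fx; rewrite (corner_hc fP) fx hcZ. Qed.

Lemma fixed_mul x y : f x = x -> f y = y -> f (x *m y) = x *m y.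
Proof.
move=> fx fy; have := @graded_mul 1 1 x y (normr1 _) (normr1 _).
by rewrite !scale1r mulr1 scale1r; apply.
Qed.

Definition fixed_proj e := [/\ hc e = e, e *m e = e & f e = e].
(** Minimality in the form [e V_1 e = C e], which makes Gram products of corner elements scalar. *)
Definition minimal e := e != 0 /\ forall x, f x = x -> exists c, e *m x *m e = c *: e.

Lemma proj_hc_comm e x : hc e = e -> hc x = x -> e *m x = x -> x *m e = x.
Proof. by move=> eh xh ex; rewrite -{1}xh -{1}eh -hcM ex. Qed.

(* Spectral projections of a fixed hermitian [h] are polynomials in [h]. *)
Lemma fixed_spectral e h U (a : 'I_d -> C) (b : C) : fixed_proj e -> U *m hc U = 1%:M ->
  hc U *m U = 1%:M -> h = fcalc U a -> f h = h -> e *m h = h -> hc h = h ->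
  let g := fcalc U (fun i => if a i == b then 1 else 0) in
  f (e *m g) = e *m g /\ e *m g = g *m e.
Proof.
move=> [eh ee fe] UU UU' hE fh eh' hh; have he := proj_hc_comm eh hh eh'.
(* [W] holds for all polynomials in the eigenvalues, with [e] in place of the unit matrix, which [f]
   need not fix. *)
pose W (q : 'I_d -> C) := f (e *m fcalc U q) = e *m fcalc U q /\ e *m fcalc U q = fcalc U q *m e.
have Wconst (c : C) : W (fun=> c).
  have cE : fcalc U (fun=> c) = c *: 1%:M.
    by rewrite -(fcalc1 UU') fcalcZ; apply: eq_fcalc => i; rewrite mulr1.
  by rewrite /W cE -scalemxAr -scalemxAl mulmx1 mul1mx linearZ /= fe.
have Wstep q (c : C) : W q -> W (fun i => q i * (a i - c)).
  move=> [fq cq]; have qE : fcalc U (fun i => q i * (a i - c)) = fcalc U q *m h - c *: fcalc U q.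
    rewrite hE fcalcM // fcalcZ fcalcB; apply: eq_fcalc => i.
    by rewrite mulrBr; congr (_ - _); rewrite mulrC.
  rewrite /W qE mulmxBr mulmxBl -scalemxAr -scalemxAl mulmxA cq; split; last first.
    by rewrite -[in LHS]mulmxA eh' -[in RHS]mulmxA he.
  by rewrite linearB linearZ /= -cq fixed_mul // fq.
have Wprod (c : C) (s : seq C) : W (fun i => c * \prod_(b' <- s) (a i - b')).
  elim: s => [|b' s IH]; rewrite /W.
    rewrite (eq_fcalc _ (h := fun=> c)); first exact: Wconst.
    by move=> i; rewrite big_nil mulr1.
  rewrite (eq_fcalc _ (h := fun i => (c * \prod_(b' <- s) (a i - b')) * (a i - b'))).
    exact: Wstep.
  by move=> i; rewrite big_cons [(a i - b') * _]mulrC mulrA.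
pose s := [seq b' <- codom a | b' != b].
(* Lagrange interpolation: the normalized product is 1 at [b] and 0 at every other eigenvalue. *)
have := Wprod (\prod_(b' <- s) (b - b'))^-1 s; rewrite /W.
rewrite (eq_fcalc _ (h := fun i => if a i == b then 1 else 0)) // => i.
case: eqP => [->|/eqP ne].
  rewrite mulVf // prodf_seq_neq0; apply/allP => b'; rewrite mem_filter /= => /andP[ne _].
  by rewrite subr_eq0 eq_sym.
apply/eqP; rewrite mulf_eq0; apply/orP; right; rewrite prodf_seq_eq0.
apply/hasP; exists (a i); last by rewrite /= subrr.
by rewrite mem_filter ne codom_f.
Qed.

(** Some hermitian component [h] of [e x e] is no multiple of [e]. It has a spectral projection
    [F b] with [e F b] nonzero, and [e F b = e] would force [h = b *: e]. *)
Lemma fixed_not_minimal e : fixed_proj e -> e != 0 -> 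
  (exists2 x, f x = x & forall c, e *m x *m e != c *: e) ->
  exists g, [/\ fixed_proj g, e *m g = g, g != 0 & g != e].
Proof.
move=> pe e0 [x fx xe]; have [eh ee fe] := pe; set y := e *m x *m e in xe.
have fy : f y = y by do 2?apply: fixed_mul.
have ey : e *m y = y by rewrite /y !mulmxA ee.
have ye : y *m e = y by rewrite /y -[in LHS]mulmxA ee.
have fhy : f (hc y) = hc y by rewrite (corner_hc fP) fy.
have ehy : e *m hc y = hc y by rewrite -{1}eh -hcM ye.
have [h [hh fh eh' hc_ne]] : exists h, [/\ hc h = h, f h = h, e *m h = h & forall c, h != c *: e].
  pose H := y + hc y; pose K := 'i *: (y - hc y).
  have yE : y = 2^-1 *: (H - 'i *: K).
    rewrite scalerA -expr2 sqrCi scaleN1r opprK addrACA subrr addr0.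
    by rewrite -mulr2n -scaler_nat scalerA mulVf ?scale1r // pnatr_eq0.
  have fH : f H = H by rewrite linearD /= fy fhy.
  have fK : f K = K by rewrite linearZ /= linearB /= fy fhy.
  have eH : e *m H = H by rewrite mulmxDr ey ehy.
  have eK : e *m K = K by rewrite -scalemxAr mulmxBr ey ehy.
  have hH : hc H = H by rewrite hcD hcK addrC.
  have hK : hc K = K by rewrite hcZ hcB hcK conjCi scaleNr -scalerN opprB.
  have vecP (w : 'M[C]_d) : ~~ (mxvec w <= mxvec e)%MS -> forall c, w != c *: e.
    by move=> + c; apply: contra => /eqP ->; rewrite linearZ /= scalemx_sub.
  case: (boolP (mxvec H <= mxvec e)%MS) => [/sub_rVP[c Hc]|/vecP]; last by exists H.
  case: (boolP (mxvec K <= mxvec e)%MS) => [/sub_rVP[c' Kc]|/vecP]; last by exists K.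
  have {}Hc : H = c *: e by apply: (can_inj mxvecK); rewrite Hc linearZ.
  have {}Kc : K = c' *: e by apply: (can_inj mxvecK); rewrite Kc linearZ.
  by have := xe (2^-1 * (c - 'i * c')); rewrite -scalerA scalerBl -scalerA -Kc -Hc -yE eqxx.
have [U [a [UU UU' hE _]]] := hermitian_fcalc hh.
pose F b := fcalc U (fun i => if a i == b then 1 else 0).
have FP b := fixed_spectral b pe UU UU' hE fh eh' hh.
have [b gb] : exists b, e *m F b != 0.
  suff /existsP[i] : [exists i, e *m F (a i) != 0] by exists (a i).
  apply: contraR e0; rewrite negb_exists => /forallP e0.
  have eU : e *m hc U = 0.
    apply/matrixP => k i; have := e0 i; rewrite negbK => /eqP.
    move=> /(congr1 (fun X => X *m hc U)); rewrite mul0mx /F /fcalc !mulmxA -mulmxA UU mulmx1.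
    by rewrite mul_mx_diag => /matrixP/(_ k i); rewrite mxE [in X in _ * X]mxE eqxx mulr1 => ->; rewrite !mxE.
  by rewrite -[e]mulmx1 -UU' mulmxA eU mul0mx.
have [fg cg] := FP b; rewrite -/(F b) in fg cg.
have FF : F b *m F b = F b.
  by rewrite fcalcM //; apply: eq_fcalc => i; case: ifP; rewrite ?mulr1 ?mulr0.
have Fh : hc (F b) = F b.
  by rewrite hc_fcalc; apply: eq_fcalc => i; case: ifP; rewrite ?conjC0 ?conjC1.
exists (e *m F b); split=> //; last 2 first.
- by rewrite mulmxA ee.
- apply/eqP => ge; have := hc_ne b; rewrite -{1}eh' -{1}ge -mulmxA.
  have -> : F b *m h = b *: F b.
    rewrite {1}hE fcalcM // fcalcZ; apply: eq_fcalc => i.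
    by case: eqP => [->|_]; rewrite ?mul1r ?mulr1 ?mul0r ?mulr0.
  by rewrite -scalemxAr ge eqxx.
split=> //; first by rewrite hcM Fh eh.
by rewrite {1}cg mulmxA -(mulmxA (F b)) ee -cg -mulmxA FF.
Qed.

Lemma proj_rankD e g h : fixed_proj g -> fixed_proj h -> fixed_proj e -> e = g + h ->
  \rank e = (\rank g + \rank h)%N.
Proof.
move=> [_ gg _] [_ hh _] [_ ee _] eE; apply/eqP.
by rewrite -(eqr_nat C) natrD -!idem_trace // eE linearD.
Qed.

Lemma minimal_decomposition e : fixed_proj e -> exists s : seq 'M[C]_d,
  [/\ forall x, x \in s -> [/\ fixed_proj x, minimal x & e *m x = x],
      pairwise (fun x y => (x *m y == 0) && (y *m x == 0)) s & \sum_(x <- s) x = e].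
Proof.
have [N] := ubnP (\rank e); elim: N e => // N IH e; rewrite ltnS => rN pe.
have [->|e0] := eqVneq e 0; first by exists [::]; split=> //; rewrite big_nil.
have [eh ee fe] := pe.
pose cut : endo := mulmxr e \o mulmx e.
(* Minimality is decided as an inclusion of row spaces: [e V_1 e] inside the line spanned by [e]. *)
case: (boolP (eigenspace (lin_mx f) 1 *m lin_mx cut <= mxvec e)%MS) => [min|/row_subPn[i]].
  exists [:: e]; split=> //=; last by rewrite big_seq1.
  move=> x; rewrite inE => /eqP->; split=> //; split=> // x' fx'.
  have /sub_rVP[c cE] : (mxvec (e *m x' *m e) <= mxvec e)%MS.
    have -> : mxvec (e *m x' *m e) = mxvec x' *m lin_mx cut by rewrite mul_vec_lin.
    by apply: submx_trans min; rewrite submxMr // mxvec_eigenspace scale1r fx'.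
  by exists c; apply: (can_inj mxvecK); rewrite cE linearZ.
rewrite row_mul => ni; set v := row i _ in ni.
have fx : f (vec_mx v) = vec_mx v.
  have := row_sub i (eigenspace (lin_mx f) 1).
  by rewrite -[row i _]vec_mxK mxvec_eigenspace scale1r => /eqP.
have [|g [pg eg g0 ge]] := fixed_not_minimal pe e0.
  exists (vec_mx v) => // c; apply: contra ni => /eqP cE.
  by rewrite -[v]vec_mxK mul_vec_lin /= cE linearZ /= scalemx_sub.
have [gh gg fg] := pg; have ge' := proj_hc_comm eh gh eg.
have ph : fixed_proj (e - g).
  split; first by rewrite hcB eh gh.
    by rewrite mulmxBr !mulmxBl ee eg ge' gg subrr subr0.
  by rewrite linearB /= fe fg.
have rD := proj_rankD pg ph pe (esym (subrKC _ _)).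
have rg : (0 < \rank g)%N by rewrite lt0n mxrank_eq0.
have rh : (0 < \rank (e - g)%R)%N by rewrite lt0n mxrank_eq0 subr_eq0 eq_sym.
have rgN : (\rank g < N)%N by apply: leq_trans rN; rewrite rD -addn1 leq_add2l.
have rhN : (\rank (e - g)%R < N)%N by apply: leq_trans rN; rewrite rD -add1n leq_add2r.
have [s1 [s1P s1o s1s]] := IH g rgN pg; have [s2 [s2P s2o s2s]] := IH (e - g) rhN ph.
have gP x : x \in s1 -> g *m x = x /\ x *m g = x.
  by move=> /s1P[[xh _ _] _ gx]; split=> //; apply: proj_hc_comm.
have hP x : x \in s2 -> (e - g) *m x = x /\ x *m (e - g) = x.
  by move=> /s2P[[xh _ _] _ hx]; split=> //; apply: proj_hc_comm; case: ph.
exists (s1 ++ s2); split.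
- move=> x; rewrite mem_cat => /orP[xs|xs].
    by have [? ? gx] := s1P _ xs; split=> //; rewrite -gx mulmxA eg.
  by have [? ? hx] := s2P _ xs; split=> //; rewrite -hx mulmxA mulmxBr ee eg.
- rewrite pairwise_cat s1o s2o !andbT; apply/allrelP => x y /gP[gx xg] /hP[hy yh].
  apply/andP; split; apply/eqP.
    by rewrite -xg -hy mulmxA -(mulmxA x) mulmxBr ge' gg subrr mulmx0 mul0mx.
  by rewrite -yh -gx mulmxA -(mulmxA y) mulmxBl eg gg subrr mulmx0 mul0mx.
- by rewrite big_cat /= s1s s2s subrKC.
Qed.

End Graded.

(** * Peirce corners of the peripheral eigenspaces *)

Section Corners.
Context {C : numClosedFieldType} {d : nat}.
Implicit Types (x y : 'M[C]_d) (z w : C).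
Notation endo := {linear 'M[C]_d -> 'M[C]_d}.
Variables (P : 'M[C]_d) (f : endo).
Hypothesis fP : graded_corner P f.
Variables (k : nat) (e : 'I_k -> 'M[C]_d).
Hypothesis ep : forall i, fixed_proj f (e i).
Hypothesis em : forall i, minimal f (e i).
Hypothesis eo : forall i j, i != j -> e i *m e j = 0.
Hypothesis es : \sum_i e i = P.

Let eh i : hc (e i) = e i. Proof. by case: (ep i). Qed.
Let ee i : e i *m e i = e i. Proof. by case: (ep i). Qed.
Let fe i : f (e i) = e i. Proof. by case: (ep i). Qed.
Let e0 i : e i != 0. Proof. by case: (em i). Qed.
Let eE i j : e i *m e j = if i == j then e i else 0.
Proof. by case: eqVneq => [->|/eo]. Qed.
Let n1 z : `|z| = 1 -> `|z^*| = 1. Proof. by rewrite norm_conjC. Qed.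

Definition corner_map i j : endo := mulmxr (e j) \o mulmx (e i).
Definition corner_space i j z := eigenspace (lin_mx f) z *m lin_mx (corner_map i j).
Definition corner_eigen i j z := (`|z| == 1) && (corner_space i j z != 0).

Lemma corner_map_eig i j z x : `|z| = 1 -> f x = z *: x ->
  f (e i *m x *m e j) = z *: (e i *m x *m e j).
Proof.
move=> z1 fx; have fe1 l : f (e l) = 1 *: e l by rewrite scale1r fe.
have := graded_mul fP (normr1 _) z1 (fe1 i) fx; rewrite mul1r => fx'.
by have := graded_mul fP z1 (normr1 _) fx' (fe1 j); rewrite mulr1.
Qed.

Lemma corner_spaceP i j z (v : 'rV_(d * d)) : `|z| = 1 -> (v <= corner_space i j z)%MS ->
  [/\ f (vec_mx v) = z *: vec_mx v, e i *m vec_mx v = vec_mx v & vec_mx v *m e j = vec_mx v].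
Proof.
move=> z1 /submxP[u ->]; rewrite mulmxA; set y := u *m _.
have : (y <= eigenspace (lin_mx f) z)%MS by apply: submxMl.
rewrite -[y]vec_mxK mxvec_eigenspace mul_vec_lin mxvecK /= => /eqP fx; split.
- exact: corner_map_eig.
- by rewrite !mulmxA ee.
- by rewrite -mulmxA ee.
Qed.

Lemma corner_eigenP i j z : reflect (`|z| = 1 /\ exists x,
  [/\ x != 0, f x = z *: x, e i *m x = x & x *m e j = x]) (corner_eigen i j z).
Proof.
apply: (iffP andP) => [[/eqP z1 /rowV0Pn[v vS v0]]|[z1 [x [x0 fx ex xe]]]].
  split=> //; have [fv ev ve] := corner_spaceP z1 vS; exists (vec_mx v); split=> //.
  by apply: contra v0 => /eqP v0; rewrite -[v]vec_mxK v0 linear0.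
split; first exact/eqP.
apply/rowV0Pn; exists (mxvec x); last by rewrite mxvec_eq0.
have {1}<- : e i *m x *m e j = x by rewrite ex xe.
rewrite -[e i *m x *m e j]/(corner_map i j x) -mul_vec_lin.
by rewrite submxMr // mxvec_eigenspace fx.
Qed.

Lemma corner_gram j z x y : `|z| = 1 -> f x = z *: x -> f y = z *: y ->
  x *m e j = x -> y *m e j = y -> exists c, hc x *m y = c *: e j.
Proof.
move=> z1 fx fy xe ye.
have fxy : f (hc x *m y) = hc x *m y.
  rewrite (graded_mul fP (n1 z1) z1 (graded_hc fP fx) fy).
  by rewrite -normCKC z1 expr1n scale1r.
have [c cE] := (em j).2 _ fxy; exists c; rewrite -cE.
by rewrite -{1}xe hcM eh -!mulmxA ye.
Qed.

Lemma corner_gram_neq0 j z x : `|z| = 1 -> f x = z *: x -> x != 0 ->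
  x *m e j = x -> exists2 c, hc x *m x = c *: e j & c != 0.
Proof.
move=> z1 fx x0 xe; have [c cE] := corner_gram z1 fx fx xe xe.
exists c => //; apply: contra x0 => /eqP c0; apply/eqP/gram_eq0.
by rewrite cE c0 scale0r.
Qed.

Lemma corner_sym i j z : corner_eigen i j z -> corner_eigen j i z^*.
Proof.
move=> /corner_eigenP[z1 [x [x0 fx ex xe]]]; apply/corner_eigenP; split; first exact: n1.
exists (hc x); split.
- by apply: contra x0 => /eqP hx0; rewrite -[x]hcK hx0 hc0.
- exact: (graded_hc fP).
- by rewrite -{1}(eh j) -hcM xe.
- by rewrite -{1}(eh i) -hcM ex.
Qed.

(** The product [x y] cannot vanish: [hc x x] is a nonzero multiple of [e j], which is a left unit
    for [y]. *)
Lemma corner_trans i j l z w : corner_eigen i j z -> corner_eigen j l w ->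
  corner_eigen i l (z * w).
Proof.
move=> /corner_eigenP[z1 [x [x0 fx ex xe]]] /corner_eigenP[w1 [y [y0 fy ey ye]]].
apply/corner_eigenP; split; first by rewrite normrM z1 w1 mulr1.
exists (x *m y); split; last 2 first.
- by rewrite mulmxA ex.
- by rewrite -mulmxA ye.
- have [c cE c0] := corner_gram_neq0 z1 fx x0 xe.
  apply/eqP => xy0; have : hc x *m (x *m y) = 0 by rewrite xy0 mulmx0.
  rewrite mulmxA cE -scalemxAl ey => /eqP; rewrite scaler_eq0 (negPf c0) (negPf y0) //.
- exact: (graded_mul fP).
Qed.

Lemma corner_one i : corner_eigen i i 1.
Proof.
apply/corner_eigenP; split; first exact: normr1.
by exists (e i); rewrite scale1r; split.
Qed.

(** Fix [x] nonzero in the corner. Both [x hc(x)] and [hc(x) y] are scalar multiples of minimal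
    projections, and associativity of [x hc(x) y] makes [y] proportional to [x]. *)
Lemma corner_rank i j z : `|z| = 1 -> \rank (corner_space i j z) = corner_eigen i j z.
Proof.
move=> z1; case: (boolP (corner_eigen i j z)) => [Dz|]; last first.
  by rewrite /corner_eigen z1 eqxx /= negbK => /eqP ->; rewrite mxrank0.
have := Dz; rewrite /corner_eigen => /andP[_ S0].
have /corner_eigenP[_ [x [x0 fx ex xe]]] := Dz.
apply/eqP; rewrite eqn_leq lt0n mxrank_eq0 S0 andbT.
apply: leq_trans (rank_leq_row (mxvec x)); apply: mxrankS; apply/row_subP => r.
move: (row_sub r (corner_space i j z)); set v := row r _ => /(corner_spaceP z1)[fy ey ye].
have hx0 : hc x != 0 by apply: contra x0 => /eqP h; rewrite -[x]hcK h hc0.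
have hxe : hc x *m e i = hc x by rewrite -{1}(eh i) -hcM ex.
have [c' xx c'0] := corner_gram_neq0 (n1 z1) (graded_hc fP fx) hx0 hxe.
have [c xy] := corner_gram z1 fx fy xe ye.
have vE : c' *: vec_mx v = c *: x.
  by rewrite -{1}ey scalemxAl -xx hcK -mulmxA xy -scalemxAr xe.
have -> : v = (c'^-1 * c) *: mxvec x.
  by rewrite -linearZ /= -scalerA -vE scalerA mulVf // scale1r vec_mxK.
exact: scalemx_sub.
Qed.

Lemma lin_mx_inj (M N : 'M[C]_(d * d)) : (forall x, mxvec x *m M = mxvec x *m N) -> M = N.
Proof.
by move=> MN; apply/row_matrixP => i; rewrite !rowE -[delta_mx 0 i]vec_mxK.
Qed.

(** The maps [x |-> e i x e j] are orthogonal idempotents whose sum is the identity on the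
    eigenspace, since [P x P = x] there. *)
Lemma corner_dim z : `|z| = 1 -> gdim f z = (\sum_i \sum_j corner_eigen i j z)%N.
Proof.
move=> z1; rewrite pair_bigA /=.
under eq_bigr => p _ do rewrite -corner_rank //.
pose B (p : 'I_k * 'I_k) := lin_mx (corner_map p.1 p.2).
apply: (@rank_orthogonal_sum C ('I_k * 'I_k)%type _ _ _ B).
- apply/row_matrixP => r; rewrite row_mul; have := row_sub r (eigenspace (lin_mx f) z).
  set v := row r _; rewrite -[v]vec_mxK mxvec_eigenspace => /eqP fx; rewrite mulmx_sumr.
  set x := vec_mx v in fx *.
  have Px : P *m x = x := corner_sub fP z1 fx.
  have xP : x *m P = x.
    have := corner_sub fP (n1 z1) (graded_hc fP fx).
    by rewrite -{1}(corner_herm fP) -hcM => /(can_inj (@hcK _ _ _)).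
  under eq_bigr => p _ do rewrite mul_vec_lin /=.
  rewrite -linear_sum; congr mxvec; rewrite -[RHS]xP -[in RHS]Px -es mulmx_suml mulmx_suml.
  rewrite -(pair_bigA _ (fun i j => e i *m x *m e j)) /=; apply: eq_bigr => i _.
  by rewrite mulmx_sumr.
- case=> i j [i' j']; apply: lin_mx_inj => x; rewrite mulmxA !mul_vec_lin /=.
  have -> : e i' *m (e i *m x *m e j) *m e j' = (e i' *m e i) *m x *m (e j *m e j').
    by rewrite !mulmxA.
  rewrite !eE xpair_eqE (eq_sym i'); case: (eqVneq i i') => [<-|_] /=; last first.
    by rewrite !mul0mx linear0 mulmx0.
  case: (eqVneq j j') => [_|_]; first by rewrite mul_vec_lin.
  by rewrite !mulmx0 linear0.
- move=> [i j] /=; apply/row_subP => r.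
  have [fy ey ye] := corner_spaceP z1 (row_sub r (corner_space i j z)).
  by rewrite -[row r _]vec_mxK mxvec_eigenspace fy.
Qed.

(** Powers of an element with primitive eigenvalue [w] are eigenvectors for the powers of [w]. Were
    the rank below [n], the eigenvalues in the Cayley-Hamilton relation would be distinct, so each
    of its terms, even the nonzero leading power, would vanish. *)
Lemma corner_order_le i n : (0 < n)%N -> (forall z, corner_eigen i i z = (z ^+ n == 1)) ->
  (n <= \rank (e i))%N.
Proof.
move=> n0 Dn; have pr := @rou_prim C n n0; set w := rou n 1 in pr.
have /corner_eigenP[w1 [x [x0 fx ex xe]]] : corner_eigen i i w.
  by rewrite Dn (prim_expr_order pr).
have [r [K [L [KL LK rE]]]] := idem_factor (ee i).
rewrite leqNgt; apply/negP; rewrite -rE {rE}.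
(* Rank zero contradicts [e i != 0]; from here on the rank is [r + 1]. *)
case: r K L KL LK => [|r] K L KL LK rn.
  by move: (e0 i); rewrite KL (flatmx0 L) mulmx0 eqxx.
have [M ML] : exists M : 'M[C]_r.+1, M *m L = L *m x.
  by exists (L *m x *m K); rewrite -!mulmxA -KL xe.
pose xp m := K *m M ^+ m *m L.
have xp0 : xp 0%N = e i by rewrite /xp expr0 mulmx1.
have xpS m : xp m.+1 = xp m *m x.
  by rewrite /xp exprSr -[M ^+ m * M]/(M ^+ m *m M) -!mulmxA ML.
have xpe m : xp m *m e i = xp m by rewrite KL /xp -!mulmxA (mulmxA L) LK mul1mx.
have [c xx c0] : exists2 c, x *m hc x = c *: e i & c != 0.
  have hx0 : hc x != 0 by apply: contra x0 => /eqP h; rewrite -[x]hcK h hc0.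
  have hxe : hc x *m e i = hc x by rewrite -{1}(eh i) -hcM ex.
  by have := corner_gram_neq0 (n1 w1) (graded_hc fP fx) hx0 hxe; rewrite hcK.
have fxp m : f (xp m) = w ^+ m *: xp m.
  elim: m => [|m IH]; first by rewrite xp0 expr0 scale1r.
  by rewrite xpS (graded_mul fP _ w1 IH fx) ?exprSr // normrX w1 expr1n.
have xp_neq0 m : xp m != 0.
  elim: m => [|m]; first by rewrite xp0.
  apply: contra => /eqP; rewrite xpS => /(congr1 (fun X => X *m hc x)).
  rewrite mul0mx -mulmxA xx -scalemxAr xpe => /eqP.
  by rewrite scaler_eq0 (negPf c0).
have sum0 : \sum_(m < r.+2) (char_poly M)`_m *: xp m = 0.
  have := Cayley_Hamilton M; rewrite -[X in horner_mx _ X]coefK poly_def size_char_poly.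
  rewrite raddf_sum /= => /(congr1 (fun X => K *m X *m L)).
  rewrite mulmx0 mul0mx mulmx_sumr mulmx_suml => E0; rewrite -[RHS]E0.
  apply: eq_bigr => m _; rewrite linearZ /= rmorphXn /= horner_mx_X.
  by rewrite -scalemxAr -scalemxAl.
have winj a b : (a < r.+2)%N -> (b < r.+2)%N -> w ^+ a = w ^+ b -> a = b.
  move=> ar br /eqP; rewrite (eq_prim_root_expr pr) !modn_small; first by move/eqP.
    exact: leq_trans br rn.
  exact: leq_trans ar rn.
have fy m : (m < r.+2)%N -> f ((char_poly M)`_m *: xp m) = w ^+ m *: ((char_poly M)`_m *: xp m).
  by move=> _; rewrite linearZ /= fxp !scalerA mulrC.
have := @eigen_sum_eq0 C _ f r.+2 _ (fun m => (char_poly M)`_m *: xp m) winj fy sum0 r.+1 (ltnSn _).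
have -> : (char_poly M)`_r.+1 = 1.
  by have := char_poly_monic M; rewrite monicE lead_coefE size_char_poly => /eqP.
by rewrite scale1r => H; move: (xp_neq0 r.+1); rewrite H eqxx.
Qed.

End Corners.

Theorem corner_data (C : numClosedFieldType) (d : nat) (P : 'M[C]_d)
    (f : {linear 'M[C]_d -> 'M[C]_d}) : graded_corner P f ->
  exists data : seq (nat * nat * seq C),
    [/\ all valid_datum data, (data_dim data <= d)%N &
      forall z, `|z| = 1 -> gdim f z = count_mem z (periph_list data)].
Proof.
move=> fP; have pP : fixed_proj f P.
  by split; [exact: (corner_herm fP) | exact: (corner_idem fP) | exact: (corner_unit fP)].
have [s [sP so ss]] := minimal_decomposition fP pP.
pose e (i : 'I_(size s)) := s`_i.
have sI (i : 'I_(size s)) : e i \in s by apply: mem_nth.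
have ep i : fixed_proj f (e i) by case: (sP _ (sI i)).
have em i : minimal f (e i) by case: (sP _ (sI i)).
have eo i j : i != j -> e i *m e j = 0.
  have H (a b : 'I_(size s)) : (a < b)%N -> (e a *m e b == 0) && (e b *m e a == 0).
    by apply: (pairwiseP 0 so); rewrite inE.
  rewrite -val_eqE neq_ltn => /orP[/H|/H] /andP[/eqP a /eqP b] //.
have es : \sum_i e i = P by rewrite -ss (big_nth 0) big_mkord.
pose D i j z := corner_eigen f e i j z.
have [L Lp] := closed_field_poly_normal (char_poly (lin_mx f)).
have DL i j z : D i j z -> z \in L.
  move=> /(corner_eigenP fP ep)[z1 [x [x0 fx _ _]]].
  have /gdim_gt0P : exists2 X, f X = z *: X & X != 0 by exists x.
  rewrite lt0n mxrank_eq0 => eig.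
  have : root (char_poly (lin_mx f)) z by rewrite -eigenvalue_root_char.
  rewrite Lp rootZ ?root_prod_XsubC // lead_coef_eq0.
  exact: (monic_neq0 (char_poly_monic _)).
have Dn i j z : D i j z -> `|z| = 1 by case/andP => /eqP.
have Dnz i : exists2 n, (0 < n)%N & forall z, D i i z = (z ^+ n == 1).
  apply: (@finite_group_unity _ (D i i) L).
  - exact: DL.
  - by move=> z /Dn z1; rewrite -normr_eq0 z1 oner_eq0.
  - exact: (corner_one fP ep em).
  - by move=> z w; apply: (corner_trans fP ep em).
have [n n0 nD] := fin_all_exists2 Dnz.
have [data [dv ddim dcount]] := peripheral_data (index_enum 'I_(size s)) DL Dn
  n0 nD (fun i j z => @corner_sym _ _ _ _ fP _ _ ep i j z)
  (fun i j k z w => @corner_trans _ _ _ _ fP _ _ ep em i j k z w).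
exists data; split=> // [|z z1]; last by rewrite dcount (corner_dim fP ep em eo es z1).
rewrite ddim.
apply: (@leq_trans (\sum_i \rank (e i))%N).
  by apply: leq_sum => i _; apply: (corner_order_le fP ep em (n0 i) (nD i)).
apply: leq_trans (rank_leq_row P).
rewrite -(ler_nat C) natr_sum -(idem_trace (corner_idem fP)) -es linear_sum /=.
by rewrite (eq_bigr (fun i => \tr (e i))) // => i _; rewrite idem_trace //; case: (ep i).
Qed.

(** * A channel realizing given data *)

Section DiagonalOperator.
Context {C : numClosedFieldType}.

Lemma mup_prod (I : Type) (r : seq I) (c : I -> C) z :
  mup z (\prod_(i <- r) ('X - (c i)%:P)) = (\sum_(i <- r) (c i == z))%N.
Proof.
elim: r => [|i r IH]; first by rewrite !big_nil mupNroot // rootC oner_eq0.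
rewrite !big_cons mupM ?polyXsubC_eq0 ?IH //; last first.
  by rewrite monic_neq0 // monic_prod_XsubC.
have := mup_XsubCX 1 z (c i); rewrite expr1 => ->.
by rewrite eq_sym; case: eqP.
Qed.

(** [T] is conjugate to entrywise multiplication by [lam], whose matrix is diagonal; in finite
    dimension a one-sided inverse of [G] suffices. *)
Lemma eig_mult_intertwine d (T G H : {linear 'M[C]_d -> 'M[C]_d}) (lam : 'M[C]_d) z :
  (forall Y, H (G Y) = Y) ->
  (forall Y, T (G Y) = G (\matrix_(i, j) (lam i j * Y i j))) ->
  eig_mult T z = (\sum_i \sum_j (lam i j == z))%N.
Proof.
move=> HG TG; rewrite /eig_mult.
have GH : lin_mx G *m lin_mx H = 1%:M.
  apply/row_matrixP => r; rewrite !rowE mulmx1 mulmxA -{1}[delta_mx 0 r]vec_mxK.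
  by rewrite !mul_vec_lin HG vec_mxK.
have /mulmx1_unit[Gu _] := GH.
have GT : lin_mx G *m lin_mx T = diag_mx (mxvec lam) *m lin_mx G.
  apply/row_matrixP => r; rewrite !rowE !mulmxA -[delta_mx 0 r]vec_mxK.
  rewrite !mul_vec_lin TG; set Y := vec_mx _.
  have -> : mxvec Y *m diag_mx (mxvec lam) = mxvec (\matrix_(i, j) (lam i j * Y i j)).
    apply/rowP => q; rewrite mul_mx_diag mxE; case/mxvec_indexP: q => i j.
    by rewrite !mxvecE mxE mulrC.
  by rewrite mul_vec_lin.
rewrite (char_poly_intertwine erefl _ GT) ?row_free_unit //.
rewrite char_poly_trig ?diag_mx_is_trig // mup_prod.
rewrite (reindex (uncurry (@mxvec_index d d))) /=; last exact: (curry_mxvec_bij d d).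
rewrite pair_bigA /=; apply: eq_bigr => -[i j] _ /=.
by rewrite mxE eqxx mulr1n mxvecE.
Qed.

End DiagonalOperator.

(** * The pinched cyclic shift with phases *)

Section Converse.
Context {C : numClosedFieldType}.
Variable data : seq (nat * nat * seq C).
Hypothesis dv : all valid_datum data.

Let N := size data.
Definition datum (c : 'I_N) := nth (0%N, 0%N, [::]) data c.
Definition cyc_len c := (datum c).1.1.
Definition blk_dim c := (datum c).1.2.
Definition phases c := (datum c).2.

Lemma datumP c : [/\ (0 < cyc_len c)%N, (0 < blk_dim c)%N, size (phases c) = blk_dim c &
  forall k, (k < blk_dim c)%N -> `|(phases c)`_k| = 1].
Proof.
have : valid_datum (datum c) by apply: (allP dv); apply: mem_nth.
rewrite /cyc_len /blk_dim /phases; case: (datum c) => [[n m] mu] /= /and4P[n0 m0 /eqP sz /allP mu1].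
by split=> // k km; apply/eqP/mu1/mem_nth; rewrite sz.
Qed.

Definition site := {c : 'I_N & ('I_(cyc_len c) * 'I_(blk_dim c))%type}.
Implicit Types (x y : site).

Lemma card_site : #|{: site}| = data_dim data.
Proof.
rewrite card_tagged sumnE big_map big_enum /data_dim (big_nth (0%N, 0%N, [::])) big_mkord.
by apply: eq_bigr => c _; rewrite card_prod !card_ord.
Qed.

Notation D := (data_dim data).
Definition site_of (i : 'I_D) : site := enum_val (cast_ord (esym card_site) i).
Definition pos_of x : 'I_D := cast_ord card_site (enum_rank x).

Lemma site_ofK : cancel site_of pos_of.
Proof. by move=> i; rewrite /pos_of /site_of enum_valK cast_ordKV. Qed.

Lemma pos_ofK : cancel pos_of site_of.
Proof. by move=> x; rewrite /pos_of /site_of cast_ordK enum_rankK. Qed.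

(** The position is taken in [nat] so that cells of different blocks compare without dependent
    types. *)
Definition cell x := (tag x, (tagged x).1 : nat).
Definition phase x := (phases (tag x))`_(tagged x).2.
Definition prev_site x : site := Tagged _ (ord_pred (tagged x).1, (tagged x).2).
Definition next_site x : site := Tagged _ (ordS (tagged x).1, (tagged x).2).
(** The default of [insubd] makes this total in [m], so a sum over the cycle of [x] can also act on
    [y], whose cycle length agrees only up to a proof. *)
Definition set_cell x (m : nat) : site := Tagged _ (insubd (tagged x).1 m, (tagged x).2).
Definition omega x : C := rou (cyc_len (tag x)) 1.

Lemma prev_siteK : cancel prev_site next_site.
Proof. by case=> c [a k]; rewrite /next_site /prev_site /= ord_predK. Qed.

Lemma next_siteK : cancel next_site prev_site.
Proof. by case=> c [a k]; rewrite /next_site /prev_site /= ordSK. Qed.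

Lemma phase_norm x : phase x * (phase x)^* = 1.
Proof.
have [_ _ _ h] := datumP (tag x).
by rewrite -normCK h ?ltn_ord // expr1n.
Qed.

Lemma cell_prev x y : (cell (prev_site x) == cell (prev_site y)) = (cell x == cell y).
Proof.
case: x y => c [a k] [c' [a' k']]; rewrite /cell /= !xpair_eqE.
case: (eqVneq c c') => //= cc; case: _ / cc a' k' => a' k'.
by rewrite -[LHS]/(ord_pred a == ord_pred a') (can_eq (@ord_predK _)).
Qed.

Definition entries (X : 'M[C]_D) x y := X (pos_of x) (pos_of y).
Definition of_entries (F : site -> site -> C) : 'M[C]_D :=
  \matrix_(i, j) F (site_of i) (site_of j).

Lemma of_entriesK F x y : entries (of_entries F) x y = F x y.
Proof. by rewrite /entries mxE !pos_ofK. Qed.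

Lemma entries_inj X Y : (forall x y, entries X x y = entries Y x y) -> X = Y.
Proof.
by move=> XY; apply/matrixP => i j; have := XY (site_of i) (site_of j); rewrite /entries !site_ofK.
Qed.

(* Pinch to the cells, shift each cell to the next one of its cycle, and conjugate
   by the diagonal unitary of the phases. *)
Definition cyc_map (X : 'M[C]_D) : 'M[C]_D := of_entries (fun x y =>
  if cell x == cell y then phase x * (phase y)^* * entries X (prev_site x) (prev_site y) else 0).

(* Fourier transform along each cycle; it diagonalizes [cyc_map]. *)
Definition fourier (X : 'M[C]_D) : 'M[C]_D := of_entries (fun x y =>
  if cell x == cell y then
    \sum_(m < cyc_len (tag x)) (omega x)^-1 ^+ (m * (tagged x).1) * entries X (set_cell x m) (set_cell y m)
  else entries X x y).

Definition inv_fourier (X : 'M[C]_D) : 'M[C]_D := of_entries (fun x y =>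
  if cell x == cell y then (cyc_len (tag x))%:R^-1 *
    \sum_(m < cyc_len (tag x)) (omega x) ^+ (m * (tagged x).1) * entries X (set_cell x m) (set_cell y m)
  else entries X x y).

(** On a common cell the position of [x] is read as a Fourier frequency; pairs from different cells
    are killed by the pinching. *)
Definition cyc_eig x y : C :=
  if cell x == cell y then phase x * (phase y)^* * (omega x) ^+ (tagged x).1 else 0.

Lemma entriesD X Y x y : entries (X + Y) x y = entries X x y + entries Y x y.
Proof. by rewrite /entries mxE. Qed.
Lemma entriesZ a X x y : entries (a *: X) x y = a * entries X x y.
Proof. by rewrite /entries mxE. Qed.

Lemma cyc_map_linear : linear cyc_map.
Proof.
move=> a X Y; apply: entries_inj => x y; rewrite entriesD entriesZ !of_entriesK !entriesD !entriesZ.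
by case: ifP => _; [ring | rewrite mulr0 addr0].
Qed.

Lemma fourier_linear : linear fourier.
Proof.
move=> a X Y; apply: entries_inj => x y; rewrite entriesD entriesZ !of_entriesK !entriesD !entriesZ.
case: ifP => _ //; rewrite mulr_sumr -big_split; apply: eq_bigr => m _.
by rewrite !entriesD !entriesZ /=; ring.
Qed.

Lemma inv_fourier_linear : linear inv_fourier.
Proof.
move=> a X Y; apply: entries_inj => x y; rewrite entriesD entriesZ !of_entriesK !entriesD !entriesZ.
case: ifP => _ //; rewrite mulrCA -mulrDr [a * _]mulr_sumr -big_split; congr (_ * _); apply: eq_bigr => m _.
by rewrite !entriesD !entriesZ /=; ring.
Qed.

HB.instance Definition _ := GRing.isLinear.Build C 'M[C]_D 'M[C]_D *:%R cyc_map cyc_map_linear.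
HB.instance Definition _ := GRing.isLinear.Build C 'M[C]_D 'M[C]_D *:%R fourier fourier_linear.
HB.instance Definition _ := GRing.isLinear.Build C 'M[C]_D 'M[C]_D *:%R inv_fourier inv_fourier_linear.

Lemma cell_set x y m : cell x == cell y -> cell (set_cell x m) == cell (set_cell y m).
Proof.
case: x y => c [a k] [c' [a' k']]; rewrite /cell /= !xpair_eqE => /andP[/eqP cc].
case: _ / cc a' k' => a' k' /= aa; by rewrite eqxx /= !val_insubd; case: ifP.
Qed.

Lemma set_cell_set x m m' : (m' < cyc_len (tag x))%N ->
  set_cell (set_cell x m) m' = set_cell x m'.
Proof.
case: x => c [a k] /= mc'; rewrite /set_cell /=.
by have -> : insubd (insubd a m) m' = insubd a m' by apply: val_inj; rewrite !val_insubd mc'.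
Qed.

Lemma set_cell_id x : set_cell x (tagged x).1 = x.
Proof.
case: x => c [a k]; rewrite /set_cell /=.
by have -> : insubd a a = a by apply: val_inj; rewrite val_insubd ltn_ord.
Qed.

Lemma set_cell_prev x m : (m < cyc_len (tag x))%N -> set_cell (prev_site x) m = set_cell x m.
Proof.
case: x => c [a k] /= mc; rewrite /set_cell /=.
by have -> : insubd (ord_pred a) m = insubd a m by apply: val_inj; rewrite !val_insubd mc.
Qed.

Lemma cell_tag x y : cell x == cell y -> tag x = tag y /\ (tagged x).1 = (tagged y).1 :> nat.
Proof. by rewrite xpair_eqE => /andP[/eqP txy /eqP]. Qed.

Lemma omega_prim x : (cyc_len (tag x)).-primitive_root (omega x).
Proof. by apply: rou_prim; case: (datumP (tag x)). Qed.

(** Orthogonality of the characters of a cycle, by the geometric sum of a nontrivial root of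
    unity. *)
Lemma fourierK Y : inv_fourier (fourier Y) = Y.
Proof.
apply: entries_inj => x y; rewrite of_entriesK; case: ifP => [xy|xy]; last by rewrite of_entriesK xy.
have [txy axy] := cell_tag xy; set n := cyc_len (tag x); set a : nat := (tagged x).1.
have pr := omega_prim x; set w := omega x in pr *.
have w0 : w != 0 by rewrite (prim_root_eq0 pr) -lt0n (prim_order_gt0 pr).
have n0 : n%:R != 0 :> C by rewrite pnatr_eq0 -lt0n; exact: (prim_order_gt0 pr).
have an : (a < n)%N by apply: ltn_ord.
transitivity (n%:R^-1 * \sum_(m' < n) (\sum_(m < n) (w ^+ a / w ^+ m') ^+ m) *
    entries Y (set_cell x m') (set_cell y m')).
  congr (_ * _); under [RHS]eq_bigr => m' _ do rewrite mulr_suml.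
  rewrite exchange_big /=; apply: eq_bigr => m _.
  rewrite of_entriesK cell_set // mulr_sumr; apply: eq_bigr => m' _.
  have m'y : (m' < cyc_len (tag y))%N by rewrite -txy.
  rewrite !set_cell_set // mulrA; congr (_ * _).
  rewrite /= val_insubd ltn_ord /omega /= -/w.
  rewrite -[rou _ 1]/w; move: (w) => v.
  by rewrite exprMn -exprVn -!exprM (mulnC m a).
rewrite (bigD1 (Ordinal an)) //= [X in _ + X]big1 => [|m' m'a].
  have wa : w ^+ a != 0 by rewrite expf_neq0.
  rewrite addr0 (divff wa) [X in _ * (X * _)](eq_bigr (fun=> 1)) => [|m _]; last by rewrite expr1n.
  have ya : set_cell y a = y by rewrite /a axy set_cell_id.
  by rewrite sumr_const card_ord mulrA mulVf // mul1r ya set_cell_id.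
set u := w ^+ a / w ^+ m'.
have un : u ^+ n = 1.
  have wn b : (w ^+ b) ^+ n = 1 by rewrite exprAC (prim_expr_order pr) expr1n.
  by rewrite /u exprMn exprVn !wn invr1 mulr1.
have u1 : u != 1.
  apply/eqP => /(canRL (mulfVK (expf_neq0 m' w0))); rewrite mul1r => /eqP.
  rewrite (eq_prim_root_expr pr) !modn_small // => /eqP e.
  by move: m'a; rewrite -val_eqE /= e eqxx.
have -> : \sum_(m < n) u ^+ m = 0.
  by have /eqP := subrX1 u n; rewrite un subrr eq_sym mulf_eq0 subr_eq0 (negPf u1) => /eqP.
by rewrite mul0r.
Qed.

Lemma cyc_map_fourier Y :
  cyc_map (fourier Y) = fourier (of_entries (fun x y => cyc_eig x y * entries Y x y)).
Proof.
apply: entries_inj => x y; rewrite !of_entriesK; case: ifP => [xy|xy]; last first.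
  by rewrite /cyc_eig xy mul0r.
have [txy axy] := cell_tag xy; have pr := omega_prim x; set w := omega x in pr *.
rewrite cell_prev xy mulr_sumr; apply: eq_bigr => m _.
have mx : (m < cyc_len (tag x))%N by [].
have my : (m < cyc_len (tag y))%N by rewrite -txy.
rewrite !set_cell_prev // of_entriesK /cyc_eig cell_set // /omega /= -/w val_insubd mx.
rewrite -/(omega _) mulrA [RHS]mulrA; congr (_ * _).
have w0 : w != 0 by rewrite (prim_root_eq0 pr) -lt0n (prim_order_gt0 pr).
(* A step back on the cycle multiplies mode [m] by [w ^+ m]; the wrap-around at position 0 is
   absorbed because [w] is a root of unity for the cycle length. *)
have -> : w^-1 ^+ (m * (ord_pred (tagged x).1)) = w ^+ m * w^-1 ^+ (m * (tagged x).1).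
  set a := (tagged x).1; have n0 := prim_order_gt0 pr; rewrite /= !exprM.
  have un : (w^-1 ^+ m) ^+ (cyc_len (tag x)) = 1.
    by rewrite exprAC exprVn (prim_expr_order pr) invr1 expr1n.
  rewrite expr_mod //; apply: (mulfI (_ : w^-1 ^+ m != 0)); first by rewrite expf_neq0 ?invr_eq0.
  rewrite -exprS prednK ?addn_gt0 ?n0 ?orbT // exprD un mulr1 mulrA exprVn.
  by rewrite mulVf ?mul1r // expf_neq0.
by rewrite /phase /=; ring.
Qed.

Lemma cyc_map_unital : unital cyc_map.
Proof.
have e1 x y : entries 1%:M x y = (x == y)%:R.
  by rewrite /entries mxE (can_eq pos_ofK).
apply: entries_inj => x y; rewrite of_entriesK !e1 (can_eq prev_siteK).
case: (eqVneq x y) => [->|_]; first by rewrite eqxx mulr1 phase_norm.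
by rewrite mulr0; case: ifP.
Qed.

Lemma cyc_map_trace : trace_preserving cyc_map.
Proof.
move=> X; rewrite /mxtrace; pose h (i : 'I_D) := pos_of (prev_site (site_of i)).
have hb : {on predT, bijective h}.
  apply: onW_bij; exists (fun i => pos_of (next_site (site_of i))) => i.
    by rewrite /h pos_ofK prev_siteK site_ofK.
  by rewrite /h pos_ofK next_siteK site_ofK.
rewrite [RHS](reindex h) //; apply: eq_bigr => i _.
by rewrite mxE eqxx phase_norm mul1r.
Qed.

(** The cell as an element of a finite type, over which sums can run. *)
Definition fcell x : {c : 'I_N & 'I_(cyc_len c)} := Tagged _ (tagged x).1.

Lemma fcell_eq x y : (fcell x == fcell y) = (cell x == cell y).
Proof.
case: x y => c [a k] [c' [a' k']]; rewrite /cell /fcell /= xpair_eqE.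
rewrite -tag_eqE /tag_eq /=; case: (eqVneq c c') => //= cc.
by case: _ / cc a' k' => a' k'; rewrite tagged_asE.
Qed.

Lemma cyc_map_cp : completely_positive cyc_map.
Proof.
move=> k X pX v.
(* Kraus form with one operator for each cell: [w b] is [v] cut to cell [b], with the phases undone
   and shifted back. *)
pose w (b : {c : 'I_N & 'I_(cyc_len c)}) (p : 'I_k * 'I_D) : C :=
  let x := next_site (site_of p.2) in
  (fcell x == b)%:R * (phase x)^* * v (p.1, pos_of x).
have : 0 <= \sum_b \sum_p \sum_q (w b p)^* * blockf X p q * w b q.
  by apply: sumr_ge0 => b _; apply: pX.
rewrite /blockf exchange_big /=.
under eq_bigr => p _ do rewrite exchange_big /=.
pose h (p : 'I_k * 'I_D) := (p.1, pos_of (prev_site (site_of p.2))).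
have hb : {on predT, bijective h}.
  apply: onW_bij; exists (fun p => (p.1, pos_of (next_site (site_of p.2)))) => -[a i].
    by rewrite /h /= pos_ofK prev_siteK site_ofK.
  by rewrite /h /= pos_ofK next_siteK site_ofK.
rewrite (reindex h) //=.
under eq_bigr => p _ do rewrite (reindex h) //=.
have wh b p : w b (h p) = (fcell (site_of p.2) == b)%:R * (phase (site_of p.2))^* * v p.
  by case: p => a i; rewrite /w /h /= pos_ofK prev_siteK site_ofK.
move=> H; apply: le_trans H _; rewrite le_eqVlt; apply/orP; left; apply/eqP.
apply: eq_bigr => p _; apply: eq_bigr => q _; rewrite mxE -fcell_eq.
rewrite (bigD1 (fcell (site_of p.2))) //= big1 ?addr0 => [|b bp]; last first.
  by rewrite !wh eq_sym (negPf bp) !mul0r conjC0 !mul0r.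
rewrite !wh eqxx mul1r [fcell (site_of q.2) == _]eq_sym rmorphM /= conjCK.
case: ifP => _; rewrite /entries /=; last by rewrite !mul0r !mulr0 mul0r.
by rewrite !mul1r; ring.
Qed.

Lemma count_block (t : nat * nat * seq C) z : size t.2 = t.1.2 ->
  count_mem z (let: (n, dc, mu) := t in
     flatten (flatten
       [seq [seq [seq mu`_k * (mu`_l)^* * rou n m | m <- iota 0 n]
              | l <- iota 0 dc] | k <- iota 0 dc])) =
  (\sum_(a < t.1.1) \sum_(k < t.1.2) \sum_(l < t.1.2)
     (t.2`_k * (t.2`_l)^* * rou t.1.1 1 ^+ a == z)%R)%N.
Proof.
case: t => [[n dc] mu] /= sz; rewrite count_mem_block //.
rewrite (big_nth 0) sz big_mkord [RHS]exchange_big; apply: eq_bigr => k _ /=.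
rewrite (big_nth 0) sz big_mkord [RHS]exchange_big; apply: eq_bigr => l _ /=.
rewrite count_map -sum1_count big_mkcond -[n in iota 0 n]subn0 -/(index_iota 0 n) big_mkord.
by apply: eq_bigr => m _ /=; rewrite rouE; case: eqP.
Qed.

(** For [z != 0] the pairs from different cells drop out, as their eigenvalue is 0; pairs in a
    common cell enumerate [periph_list]. *)
Lemma cyc_map_eig_mult z : z != 0 -> eig_mult cyc_map z = count_mem z (periph_list data).
Proof.
move=> z0; pose lam := of_entries cyc_eig.
rewrite (@eig_mult_intertwine _ _ cyc_map fourier inv_fourier lam z fourierK); last first.
  move=> Y; rewrite /= cyc_map_fourier; congr fourier; apply: entries_inj => x y.
  by rewrite of_entriesK /entries !mxE !pos_ofK.
have sum_pos (g : site -> nat) : (\sum_(i < D) g (site_of i) = \sum_x g x)%N.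
  by rewrite [RHS](reindex site_of) //; apply: onW_bij; exists pos_of; [exact: site_ofK | exact: pos_ofK].
have sum_site (g : site -> nat) : (\sum_x g x = \sum_(c < N) \sum_(a < cyc_len c)
    \sum_(k < blk_dim c) g (Tagged _ (a, k)))%N.
  transitivity (\sum_(c < N) \sum_(p : 'I_(cyc_len c) * 'I_(blk_dim c)) g (Tagged _ p))%N.
    by rewrite sig_big_dep /=; apply: eq_bigr => -[c p].
  by apply: eq_bigr => c _; rewrite pair_bigA; apply: eq_bigr => -[a k].
transitivity (\sum_x \sum_y (cyc_eig x y == z))%N.
  rewrite -(sum_pos (fun x => \sum_y (cyc_eig x y == z))%N); apply: eq_bigr => i _.
  rewrite -(sum_pos (fun y => (cyc_eig (site_of i) y == z) : nat)).
  by apply: eq_bigr => j _; rewrite mxE.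
rewrite sum_site /periph_list count_flatten sumnE !big_map (big_nth (0%N, 0%N, [::])) big_mkord.
apply: eq_bigr => c _; rewrite count_block; last by case: (datumP c).
apply: eq_bigr => a _; apply: eq_bigr => k _; rewrite sum_site.
have off x y : cell x != cell y -> (cyc_eig x y == z) = false.
  by rewrite /cyc_eig => /negPf ->; rewrite eq_sym (negPf z0).
rewrite (bigD1 c) //= [X in (_ + X)%N]big1 ?addn0 => [|c' c'c]; last first.
  rewrite big1 // => a' _; rewrite big1 // => l _; rewrite off //.
  by rewrite /cell xpair_eqE /= eq_sym (negPf c'c).
rewrite (bigD1 a) //= [X in (_ + X)%N]big1 ?addn0 => [|a' a'a]; last first.
  rewrite big1 // => l _; rewrite off //.
  by rewrite /cell xpair_eqE /= eqxx eq_sym -val_eqE in a'a *.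
by apply: eq_bigr => l _; rewrite /cyc_eig /cell /= eqxx.
Qed.

End Converse.

Lemma periph_list_norm (C : numClosedFieldType) (data : seq (nat * nat * seq C)) z :
  all valid_datum data -> z \in periph_list data -> `|z| = 1.
Proof.
move=> dv /flattenP[_ /mapP[[[n dc] mu] /(allP dv) vd ->]].
move: vd => /= /and4P[n0 _ /eqP sz mu1] /flattenP[s /flattenP[ss /mapP[k + ->]]].
rewrite mem_iota /= => kd /mapP[l + ->]; rewrite mem_iota /= => ld /mapP[m _ ->].
have mu_norm j : (j < dc)%N -> `|mu`_j| = 1 by move=> jd; apply/eqP/(allP mu1)/mem_nth; rewrite sz.
by rewrite !normrM norm_conjC !mu_norm // (unity_norm n0 (rou_expr m n0)) !mulr1.
Qed.

(** [schwarz] provides a bare function [Ts]; nondegeneracy of the trace pairing supplies its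
    linearity. *)
Lemma is_adjoint_linear (C : numClosedFieldType) d (T Ts : 'M[C]_d -> 'M[C]_d) :
  is_adjoint T Ts -> lin_map Ts.
Proof.
move=> adj a A B; apply: trM_inj => X.
by rewrite mulmxDr -scalemxAr linearD linearZ /= !adj mulmxDr -scalemxAr linearD linearZ.
Qed.

Lemma schwarz_spectrum (C : numClosedFieldType) d (T : 'M[C]_d -> 'M[C]_d) :
  lin_map T -> positive_map T -> trace_preserving T -> schwarz T ->
  exists data : seq (nat * nat * seq C),
    all valid_datum data /\ (data_dim data <= d)%N /\
    forall z : C,
      (if `|z| == 1 then eig_mult T z else 0%N) = count_mem z (periph_list data).
Proof.
move=> Tlin Tpos Ttr [Ts [adj Tsch]].
pose Tl : {linear 'M[C]_d -> 'M[C]_d} :=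
  HB.pack T (GRing.isLinear.Build C 'M[C]_d 'M[C]_d *:%R T Tlin).
pose Sl : {linear 'M[C]_d -> 'M[C]_d} :=
  HB.pack Ts (GRing.isLinear.Build C 'M[C]_d 'M[C]_d *:%R Ts (is_adjoint_linear adj)).
have [P [f [fP fm]]] := @peripheral_corner C d Tl Sl adj Tpos Ttr Tsch.
have [data [dv dd dc]] := corner_data fP.
exists data; split=> //; split=> // z; case: eqP => [z1|z1].
  by rewrite -dc // -fm.
apply/esym/eqP; rewrite -leqn0 leqNgt -has_count has_pred1.
by apply/negP => /(periph_list_norm dv).
Qed.

Theorem theorem9 (C : numClosedFieldType) :
  (forall (d : nat) (T : 'M[C]_d -> 'M[C]_d),
     lin_map T -> positive_map T -> trace_preserving T -> schwarz T ->
     exists data : seq (nat * nat * seq C),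
       all valid_datum data /\ (data_dim data <= d)%N /\
       forall z : C,
         (if `|z| == 1 then eig_mult T z else 0%N) = count_mem z (periph_list data))
  /\
  (forall data : seq (nat * nat * seq C),
     all valid_datum data ->
     exists T : 'M[C]_(data_dim data) -> 'M[C]_(data_dim data),
       [/\ lin_map T, completely_positive T, trace_preserving T & unital T] /\
           (forall z : C,
              (if `|z| == 1 then eig_mult T z else 0%N) = count_mem z (periph_list data)) /\
         (forall z : C, z != 0 -> `|z| != 1 -> eig_mult T z = 0%N)).
Proof.
split=> [d T|data dv]; first exact: schwarz_spectrum.
have count0 z : `|z| != 1 -> count_mem z (periph_list data) = 0%N.
  move=> z1; apply/eqP; rewrite -leqn0 leqNgt -has_count has_pred1.
  by apply: contra z1 => /(periph_list_norm dv) ->.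
exists (@cyc_map C data); split; last split.
- split; [exact: cyc_map_linear | exact: cyc_map_cp | exact: (cyc_map_trace dv) | exact: (cyc_map_unital dv)].
- move=> z; case: (boolP (`|z| == 1)) => [/eqP z1|z1]; last by rewrite count0.
  by rewrite (cyc_map_eig_mult dv) // -normr_eq0 z1 oner_eq0.
- by move=> z z0 z1; rewrite (cyc_map_eig_mult dv) // count0.
Qed.
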